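(* Let $E$ be a locally convex-solid Riesz space, let $X$ be a Banach space, and let $T:E\rightarrow X$ be an operator. Then $T$ is generalized $b$-weakly compact if and only if the sequence $(Tx_{n})$ is (norm) convergent in $X$ for each increasing and topologically bounded sequence $(x_{n})\subset E^{+}$.
   Context: Conventions: locally convex spaces are real and Hausdorff, Riesz spaces are archimedean, and an operator is a linear map (not assumed continuous). A locally convex-solid Riesz space is a Riesz space with a locally convex topology having a base of zero neighborhoods consisting of convex solid sets (equivalently, generated by Riesz seminorms). $E^{+}$ is the positive cone of $E$. $E^{\prime}$ is the topological dual of $E$ with the strong topology $\beta(E^{\prime},E)$, and $E^{\prime\prime}$ is the strong bidual (the topological dual of $(E^{\prime},\beta(E^{\prime},E))$); both are Riesz spaces for the usual dual orderings, and $E$ is regarded as a Riesz subspace of $E^{\prime\prime}$ via the canonical embedding. ''Topologically bounded'' means bounded for the topology of $E$. A subset $A\subset E$ is topologically $b$-order bounded if it is order bounded as a subset of $E^{\prime\prime}$. An operator $T:E\to X$ into a Banach space is generalized $b$-weakly compact (gbwc) if it maps topologically $b$-order bounded subsets of $E$ to relatively weakly compact subsets of $X$. *)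

(* Defs.v *)
From HB Require Import structures.
From mathcomp Require Import all_boot all_order all_algebra.
From mathcomp Require Import all_classical all_reals all_analysis.

Set Implicit Arguments.
Unset Strict Implicit.
Unset Printing Implicit Defensive.

Import Order.TTheory GRing.Theory Num.Theory.
Import numFieldNormedType.Exports.

Local Open Scope classical_set_scope.
Local Open Scope ring_scope.

HB.mixin Record POrderedZmodule_isRieszSpace (R : realType) E
    & Num.POrderedZmodule E & GRing.Lmodule R E := {
  riesz_leD2r : forall z x y : E, x <= y -> x + z <= y + z ;
  riesz_scaler_ge0 : forall (a : R) (x : E), 0 <= a -> 0 <= x -> 0 <= a *: x ;
  riesz_join : E -> E -> E ;
  riesz_leUx : forall x y z : E, (riesz_join x y <= z) = (x <= z) && (y <= z) ;
  riesz_archimedean : forall x y : E,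
    0 <= x -> (forall n, x *+ n <= y) -> x = 0
}.

(* The library's lattice structures cannot be
   reused: Hierarchy-Builder rejects a new join of a lattice and a zmodType
   because Num.RealDomain already inherits from both. An ordered vector space
   with binary suprema also has binary infima, so the join is enough. *)
#[short(type="rieszSpaceType")]
HB.structure Definition RieszSpace (R : realType) :=
  {E of Num.POrderedZmodule E & GRing.Lmodule R E
      & POrderedZmodule_isRieszSpace R E}.

Definition riesz_abs (R : realType) (E : rieszSpaceType R) (x : E) : E :=
  riesz_join x (- x).

Definition solid (R : realType) (E : rieszSpaceType R) (A : set E) :=
  forall x y : E, A y -> riesz_abs x <= riesz_abs y -> A x.

HB.mixin Record RieszSpace_Tvs_isLCSolid (R : realType) E
    & RieszSpace R E & Tvs R E := {
  lcsolid_hausdorff : hausdorff_space E ;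
  lcsolid_base : forall U : set E, nbhs 0 U ->
    exists V : set E, [/\ nbhs 0 V, convex_set V, solid V & V `<=` U]
}.

#[short(type="lcSolidRieszType")]
HB.structure Definition LCSolidRiesz (R : realType) :=
  {E of RieszSpace R E & Tvs R E & RieszSpace_Tvs_isLCSolid R E}.

(* von Neumann boundedness; the library's bounded_set is about norms *)
Definition topologically_bounded (R : realType) (E : preTopologicalLmodType R)
    (A : set E) :=
  forall U : set E, nbhs 0 U ->
    exists2 r : R, 0 < r & A `<=` [set r *: u | u in U].

Section Dual.
Context (R : realType) (E : preTopologicalLmodType R).

Definition continuous_linear : {pred E -> R^o} :=
  [pred f : E -> R^o | `[< linear f /\ continuous f >]].

Lemma continuous_linear_submod_closed : submod_closed continuous_linear.
Proof.
split=> [|a f g].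
  apply/asboolP; split=> [a x y|x]; last exact: cvg_cst.
  by rewrite [RHS](_ : _ = a *: 0 + 0) // addr0 scaler0.
move=> /asboolP[lf cf] /asboolP[lg cg]; apply/asboolP; split.
  move=> b x y; rewrite [LHS](_ : _ = a *: f (b *: x + y) + g (b *: x + y)) //.
  by rewrite lf lg !scalerDr !scalerA [a * b]mulrC addrACA -scalerA -scalerDr.
move=> x; apply: (@cvgD _ R^o); last exact: cg.
by apply: (@cvgZl_tmp _ R^o); exact: cf.
Qed.

HB.instance Definition _ := GRing.isSubmodClosed.Build R (E -> R^o)
  continuous_linear continuous_linear_submod_closed.

Record dual := Dual {
  dual_fun :> E -> R^o ;
  dual_funP : dual_fun \in continuous_linear }.

HB.instance Definition _ := [isSub for dual_fun].
HB.instance Definition _ := [Choice of dual by <:].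
HB.instance Definition _ := [SubChoice_isSubLmodule of dual by <:].

Lemma dual_linear (f : dual) : linear f.
Proof. by have /asboolP[] := dual_funP f. Qed.

Lemma dual_continuous (f : dual) : continuous f.
Proof. by have /asboolP[] := dual_funP f. Qed.

HB.instance Definition _ (f : dual) :=
  GRing.isLinear.Build R E R^o *:%R f (dual_linear f).

(* strong topology: uniform convergence on the bounded subsets of E *)
HB.instance Definition _ := Uniform.copy dual (initial_topology
  (dual_fun : dual -> {family @topologically_bounded R E, E -> R^o})).

End Dual.

Section Evaluation.
Context (R : realType) (E : topologicalLmodType R).

Lemma topologically_bounded1 (x : E) : topologically_bounded [set x].
Proof.
move=> U U0.
have cx : (a : R^o) *: x @[a --> (0 : R^o)] --> (0 : E).
  rewrite -[X in _ --> X](scale0r x).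
  have cp : ((a : R^o), x) @[a --> (0 : R^o)] --> (0 : R^o, x).
    by apply: (cvg_pair (G := nbhs (0 : R^o)) (H := nbhs x));
      [exact: cvg_id|exact: cvg_cst].
  exact: cvg_comp cp (@scale_continuous R E (0, x)).
have /nbhs_ballP[e /= e0 eU] := cx _ U0.
have e20 : 0 < e / 2 by rewrite divr_gt0.
exists (e / 2)^-1; first by rewrite invr_gt0.
move=> _ ->; exists ((e / 2) *: x); last by rewrite scalerA mulVf ?scale1r// gt_eqF.
apply: eU; rewrite -ball_normE /= sub0r normrN gtr0_norm//.
by rewrite ltr_pdivrMr// ltr_pMr// ltr1n.
Qed.

Definition eval_at (x : E) : dual E -> R^o := fun f => f x.

Lemma eval_at_continuous_linear (x : E) :
  eval_at x \in @continuous_linear R (dual E).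
Proof.
apply/asboolP; split=> [//|f].
have cf : continuous (@dual_fun R E : dual E ->
    {family @topologically_bounded R E, E -> R^o}) by exact: initial_continuous.
have FF : Filter (@dual_fun R E @ nbhs f) by exact: fmap_filter.
have /(fam_cvgP _ _ FF)/(_ _ (@topologically_bounded1 x)) := cf f.
by rewrite (uniform_set1 _ _ FF).
Qed.

Definition bidual_embedding (x : E) : dual (dual E) :=
  Dual (eval_at_continuous_linear x).

End Evaluation.

Definition dual_cone (R : realType) (E : preTopologicalLmodType R)
    (C : set E) : set (dual E) :=
  [set f : dual E | forall x, C x -> 0 <= f x].

Definition bidual_le (R : realType) (E : lcSolidRieszType R)
    (phi psi : dual (dual E)) :=
  dual_cone (dual_cone [set x : E | 0 <= x]) (psi - phi).

Definition topologically_b_order_bounded (R : realType)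
    (E : lcSolidRieszType R) (A : set E) :=
  exists phi psi : dual (dual E), forall x, A x ->
    bidual_le phi (bidual_embedding x) /\ bidual_le (bidual_embedding x) psi.

Definition weak_topology (R : realType) (X : preTopologicalLmodType R) :=
  initial_topology ((fun x f => f x) : X -> {ptws dual X -> R^o}).

Definition relatively_weakly_compact (R : realType)
    (X : preTopologicalLmodType R) (A : set X) :=
  compact (closure (A : set (weak_topology X))).

Definition generalized_b_weakly_compact (R : realType) (E : lcSolidRieszType R)
    (X : completeNormedModType R) (T : {linear E -> X}) :=
  forall A : set E,
    topologically_b_order_bounded A -> relatively_weakly_compact (T @` A).

(* Main.v *)
Require Import Defs.
From HB Require Import structures.
From mathcomp Require Import all_boot all_order all_algebra.
From mathcomp Require Import all_classical all_reals all_analysis.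
From mathcomp Require Import ring lra.

Set Implicit Arguments.
Unset Strict Implicit.
Unset Printing Implicit Defensive.

Import Order.TTheory GRing.Theory Num.Theory.
Import numFieldNormedType.Exports.

Local Open Scope classical_set_scope.
Local Open Scope ring_scope.

(* Sufficiency.  Let u in E'' be positive and let P be the set of x >= 0 in E
   with x <= u; it is solid, closed under joins and topologically bounded.
   For e > 0 a lim sup argument on joins of elements of P produces a positive
   form phi such that |T x| <= e for all x in P with phi x <= 1.  The quantity
   sup sum_i phi_i(x)^2 / sup_P phi_i, taken over the decompositions
   phi = sum_i phi_i, plays the role of the squared norm of L2(phi), although
   phi need not be represented by a measure: decompositions can be refined, so
   the parallelogram law holds up to an arbitrarily small error.  Minimising
   this quantity over the midpoint convex sets charged by an ultrafilter on the
   image then yields, for each e, a point of the image that is e-close to the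
   ultrafilter limit uniformly over the unit ball of the dual of X.

   Necessity.  An increasing bounded sequence (x_n) is dominated in E'' by the
   functional f |-> lim f(x_n), so T sends all sums of c_n (x_(n+1) - x_n) with
   |c_n| <= 1 into one weakly compact set, and an Orlicz-Pettis argument makes
   (T x_n) Cauchy. *)

(** * Sublinear functionals and the Hahn-Banach theorem *)

(** The model for sufficiency: if phi were a measure, [P] would lie in a ball of L-infinity, hence
    be bounded in L2(phi), whose uniform convexity yields weak compactness, while smallness in
    L1(phi) makes [T] small. Two obstacles shape the argument. [T] is not assumed continuous, so
    every bound on it comes from convergence along increasing sequences: repeated failures of the
    bound are added up to an increasing sequence of [P] whose image does not converge. And E is not
    represented by functions, nor are the lattice operations of E'' constructed; the substitute is a
    Hahn-Banach choice of a form g with 0 <= g <= f and g(x) = f(x^+), which serves both to refine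
    decompositions and to show that the elements below u are closed under joins. As phi depends on
    e, the approximate limits belong to different energies; being uniform over the dual ball, they
    are glued in norm. *)

Section HahnBanach.
Context (R : realType) (V : lmodType R).
Implicit Types (f q : V -> R) (x y z : V) (a t : R).

Definition linear_form f := forall a x y, f (a *: x + y) = a * f x + f y.

Definition sublinear q :=
  (forall a y, 0 <= a -> q (a *: y) <= a * q y) /\
  (forall y z, q (y + z) <= q y + q z).

Lemma linear_formD f x y : linear_form f -> f (x + y) = f x + f y.
Proof. by move=> lf; rewrite -{1}[x]scale1r lf mul1r. Qed.

Lemma linear_form0 f : linear_form f -> f 0 = 0.
Proof.
by move=> lf; have := linear_formD 0 0 lf; rewrite addr0; lra.
Qed.

Lemma linear_formZ f a x : linear_form f -> f (a *: x) = a * f x.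
Proof. by move=> lf; rewrite -[_ *: _]addr0 lf linear_form0// addr0. Qed.

Lemma linear_formN f x : linear_form f -> f (- x) = - f x.
Proof. by move=> lf; rewrite -scaleN1r linear_formZ// mulN1r. Qed.

Lemma linear_formB f x y : linear_form f -> f (x - y) = f x - f y.
Proof. by move=> lf; rewrite linear_formD// linear_formN. Qed.

Lemma linear_form_sum f (I : Type) (r : seq I) (P : pred I) (F : I -> V) :
  linear_form f -> f (\sum_(i <- r | P i) F i) = \sum_(i <- r | P i) f (F i).
Proof.
move=> lf; elim/big_rec2 : _ => [|i u v _ <-]; first exact: linear_form0.
exact: linear_formD.
Qed.

Lemma sublinear0 q : sublinear q -> q 0 = 0.
Proof.
move=> [hq sq]; apply/eqP; rewrite eq_le; apply/andP; split.
  by have := hq 0 0 (lexx _); rewrite scale0r mul0r.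
by have := sq 0 0; rewrite addr0; lra.
Qed.

Lemma sublinearZ q a y : sublinear q -> 0 <= a -> q (a *: y) = a * q y.
Proof.
move=> sq; rewrite le_eqVlt => /predU1P[<-|a0].
  by rewrite scale0r mul0r sublinear0.
apply/eqP; rewrite eq_le (sq.1 _ _ (ltW a0))/=.
have := sq.1 a^-1 (a *: y); rewrite invr_ge0 (ltW a0) => /(_ isT).
by rewrite scalerA mulVf ?gt_eqF// scale1r ler_pdivlMl.
Qed.

Lemma sublinear_geN q y : sublinear q -> - q (- y) <= q y.
Proof. by move=> sq; have := sq.2 y (- y); rewrite subrr (sublinear0 sq); lra. Qed.

(** The witness, the infimum over t >= 0 of q(y + t x) - t q(x), is the largest sublinear functional
    below [q] with value at most [- q x] at [- x]. Every linear form below it agrees with [q] at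
    [x]. *)
Lemma sublinear_tilt q x : sublinear q ->
  exists q', [/\ sublinear q', forall y, q' y <= q y & q' (- x) <= - q x].
Proof.
move=> sq; pose A y := [set q (y + t *: x) - t * q x | t in [set t | 0 <= t]].
have Alb y : lbound (A y) (- q (- y)).
  move=> _ [t /= t0 <-]; have := sq.2 (y + t *: x) (- y).
  by rewrite addrC addrA addNr add0r (sublinearZ _ sq t0); lra.
have infA y t : 0 <= t -> inf (A y) <= q (y + t *: x) - t * q x.
  by move=> t0; apply: ge_inf; [exists (- q (- y)); exact: Alb|exists t].
have A0 y : A y !=set0 by exists (q (y + 0 *: x) - 0 * q x); exists 0 => /=.
exists (fun y => inf (A y)); split=> [|y|].
- split=> [a y|y z].
    rewrite le_eqVlt => /predU1P[<-|a0].
      have := infA (0 *: y) 0 (lexx _).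
      by rewrite !scale0r addr0 !mul0r subr0 (sublinear0 sq).
    rewrite mulrC -ler_pdivrMr//; apply: lb_le_inf => // _ [t /= t0 <-].
    rewrite ler_pdivrMr//; apply: (le_trans (infA _ (a * t) _)).
      exact: mulr_ge0 (ltW a0) t0.
    by rewrite -scalerA -scalerDr (sublinearZ _ sq (ltW a0)); lra.
  rewrite -lerBlDr; apply: lb_le_inf => // _ [t /= t0 <-].
  rewrite lerBlDr -lerBlDl; apply: lb_le_inf => // _ [s /= s0 <-].
  rewrite lerBlDl; apply: (le_trans (infA _ (t + s) _)); first exact: addr_ge0.
  by have := sq.2 (y + t *: x) (z + s *: x); rewrite scalerDl addrACA; lra.
- by have := infA y 0 (lexx _); rewrite scale0r addr0 mul0r subr0.
- by have := infA (- x) 1 ler01; rewrite scale1r addNr (sublinear0 sq); lra.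
Qed.

(* A sublinear functional that is minimal for the pointwise order is linear:
   tilting it in any direction cannot decrease it. *)
Lemma hahn_banach q x : sublinear q ->
  exists f, [/\ linear_form f, forall y, f y <= q y & f x = q x].
Proof.
move=> /(sublinear_tilt x)[p [sp pq px]].
pose S := [set s : V -> R | sublinear s /\ forall y, s y <= p y].
(* The order is reversed, so that Zorn's maximal element is a minimal functional. *)
pose Rel (s s' : S) := `[< forall y, sval s' y <= sval s y >].
have Sp : S p by split.
have [| | | |[m mS] mmin] := @Zorn _ Rel.
- by move=> s; apply/asboolP.
- move=> r s t /asboolP rs /asboolP st; apply/asboolP => y.
  exact: le_trans (st y) (rs y).
- move=> [s Ss] [t St] /asboolP/= st /asboolP/= ts.
  by apply/eq_exist/funext => y; apply/eqP; rewrite eq_le st ts.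
- move=> A totA; have [->|/set0P[s0 As0]] := eqVneq A set0.
    by exists (SigSub (mem_set Sp)).
  + pose B y := [set sval s y | s in A].
    have Blb y : lbound (B y) (- p (- y)).
      move=> _ [s As <-]; have [ss sle] := set_mem (svalP s).
      by have := sublinear_geN y ss; have := sle (- y); lra.
    have infB y s : A s -> inf (B y) <= sval s y.
      by move=> As; apply: ge_inf; [exists (- p (- y)); exact: Blb|exists s].
    have B0 y : B y !=set0 by exists (sval s0 y); exists s0.
    have SB : S (fun y => inf (B y)).
      split=> [|y]; last first.
        by apply: (le_trans (infB _ _ As0)); exact: (set_mem (svalP s0)).2.
      split=> [a y|y z].
        rewrite le_eqVlt => /predU1P[<-|a0].
          rewrite scale0r mul0r; apply: (le_trans (infB _ _ As0)).
          by rewrite sublinear0//; exact: (set_mem (svalP s0)).1.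
        rewrite mulrC -ler_pdivrMr//; apply: lb_le_inf => // _ [s As <-].
        rewrite ler_pdivrMr//; apply: (le_trans (infB _ _ As)).
        by rewrite mulrC; apply: (set_mem (svalP s)).1.1; exact: ltW.
      rewrite -lerBlDr; apply: lb_le_inf => // _ [s As <-].
      rewrite lerBlDr -lerBlDl; apply: lb_le_inf => // _ [t At <-].
      rewrite lerBlDl; have [/asboolP st|/asboolP ts] := totA _ _ As At.
        apply: (le_trans (infB _ _ At)).
        have := (set_mem (svalP t)).1.2 y z; have := st y; lra.
      apply: (le_trans (infB _ _ As)).
      have := (set_mem (svalP s)).1.2 y z; have := ts z; lra.
    exists (SigSub (mem_set SB)) => s As; apply/asboolP => y /=.
    exact: infB.
have [sm mp] := set_mem mS.
have madd y z : m (y + z) = m y + m z.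
  apply/eqP; rewrite eq_le sm.2/=; have [s [ss sm' sz]] := sublinear_tilt z sm.
  have Ss : S s by split=> // w; apply: le_trans (mp w).
  have /mmin/(congr1 sval)/= E :
      Rel (exist _ m mS) (SigSub (mem_set Ss)) by apply/asboolP.
  rewrite E in ss sz; have := ss.2 (y + z) (- z); rewrite addrK; lra.
have m0 := sublinear0 sm.
have mN y : m (- y) = - m y.
  by have := madd y (- y); rewrite subrr m0; lra.
have mZ a y : m (a *: y) = a * m y.
  have [a0|/ltW a0] := leP 0 a; first exact: sublinearZ.
  by rewrite -[LHS]opprK -mN -scaleNr (sublinearZ _ sm) ?oppr_ge0// mulNr opprK.
exists m; split=> [a y z|y|]; first by rewrite madd mZ.
  exact: le_trans (mp y) (pq y).
have := mp (- x); rewrite mN; have := le_trans (mp x) (pq x); lra.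
Qed.

End HahnBanach.

(** * Riesz spaces *)

Section RieszSpace.
Context (R : realType) (E : rieszSpaceType R).
Implicit Types x y z t : E.

Lemma rleD2r z x y : (x + z <= y + z) = (x <= y).
Proof.
apply/idP/idP => [|xy]; last exact: riesz_leD2r.
by move/(riesz_leD2r (- z)); rewrite !addrK.
Qed.

Lemma rleD x y z t : x <= y -> z <= t -> x + z <= y + t.
Proof.
move=> xy zt; apply: (@le_trans _ _ (y + z)); first by rewrite rleD2r.
by rewrite ![y + _]addrC rleD2r.
Qed.

Lemma rleBlDr x y z : (x - y <= z) = (x <= z + y).
Proof. by rewrite -[LHS](rleD2r y) subrK. Qed.

Lemma rleBrDr x y z : (x <= y - z) = (x + z <= y).
Proof. by rewrite -[LHS](rleD2r z) subrK. Qed.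

Lemma rsub_ge0 x y : (0 <= y - x) = (x <= y).
Proof. by rewrite rleBrDr add0r. Qed.

Lemma raddr_ge0 x y : 0 <= x -> 0 <= y -> 0 <= x + y.
Proof. by move=> x0 y0; have := rleD x0 y0; rewrite addr0. Qed.

Lemma rleN2 x y : (- x <= - y) = (y <= x).
Proof. by rewrite -[LHS]rsub_ge0 opprK addrC rsub_ge0. Qed.

Lemma rleZ (a : R) x y : 0 <= a -> x <= y -> a *: x <= a *: y.
Proof.
move=> a0 xy; rewrite -rsub_ge0 -scalerBr.
by apply: riesz_scaler_ge0; rewrite ?rsub_ge0.
Qed.

Lemma rleZ2 (a : R) x y : 0 < a -> (a *: x <= a *: y) = (x <= y).
Proof.
move=> a0; apply/idP/idP => [|xy]; last exact: rleZ (ltW a0) xy.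
have a1 : 0 <= a^-1 by rewrite invr_ge0 ltW.
by move/(rleZ a1); rewrite !scalerA mulVf ?gt_eqF// !scale1r.
Qed.

Lemma rsumr_ge0 (I : Type) (r : seq I) (P : pred I) (F : I -> E) :
  (forall i, P i -> 0 <= F i) -> 0 <= \sum_(i <- r | P i) F i.
Proof.
by move=> F0; elim/big_ind : _ => // x y; exact: raddr_ge0.
Qed.

Lemma rle_joinl x y : x <= riesz_join x y.
Proof. by have := lexx (riesz_join x y); rewrite riesz_leUx => /andP[]. Qed.

Lemma rle_joinr x y : y <= riesz_join x y.
Proof. by have := lexx (riesz_join x y); rewrite riesz_leUx => /andP[]. Qed.

Lemma rjoin_le x y z : x <= z -> y <= z -> riesz_join x y <= z.
Proof. by rewrite riesz_leUx => -> ->. Qed.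

Lemma rjoinDr x y z : riesz_join (x + z) (y + z) = riesz_join x y + z.
Proof.
apply/eqP; rewrite eq_le; apply/andP; split.
  by apply: rjoin_le; rewrite rleD2r ?rle_joinl ?rle_joinr.
by rewrite -rleBrDr; apply: rjoin_le; rewrite rleBrDr ?rle_joinl ?rle_joinr.
Qed.

Definition rpos x := riesz_join x 0.

Lemma rpos_ge0 x : 0 <= rpos x. Proof. exact: rle_joinr. Qed.

Lemma rle_pos x : x <= rpos x. Proof. exact: rle_joinl. Qed.

Lemma rpos_le x y : x <= y -> 0 <= y -> rpos x <= y.
Proof. exact: rjoin_le. Qed.

Lemma rpos_id x : 0 <= x -> rpos x = x.
Proof. by move=> x0; apply/eqP; rewrite eq_le rle_pos rpos_le. Qed.

Lemma rpos_eq0 x : x <= 0 -> rpos x = 0.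
Proof. by move=> x0; apply/eqP; rewrite eq_le rpos_ge0 rpos_le. Qed.

Lemma rpos_posN x : rpos x - rpos (- x) = x.
Proof.
rewrite /rpos; have := rjoinDr x 0 (- x).
rewrite subrr add0r => /(congr1 (fun z => z + x)); rewrite subrK => <-.
have -> : riesz_join 0 (- x) = riesz_join (- x) 0.
  by apply/eqP; rewrite eq_le !rjoin_le ?rle_joinl ?rle_joinr.
by rewrite addrAC subrr add0r.
Qed.

Lemma rposD x y : rpos (x + y) <= rpos x + rpos y.
Proof.
apply: rpos_le; first by apply: rleD; exact: rle_pos.
by apply: raddr_ge0; exact: rpos_ge0.
Qed.

Lemma rposZ (a : R) x : 0 <= a -> rpos (a *: x) = a *: rpos x.
Proof.
rewrite le_eqVlt => /predU1P[<-|a0]; first by rewrite !scale0r rpos_id.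
have le_posZ (b : R) y : 0 < b -> rpos (b *: y) <= b *: rpos y.
  move=> b0; apply: rpos_le; first by rewrite rleZ2// rle_pos.
  by apply: riesz_scaler_ge0 (ltW b0) (rpos_ge0 _).
apply/eqP; rewrite eq_le le_posZ//=.
rewrite -(rleZ2 (a := a^-1)) ?invr_gt0// scalerA mulVf ?gt_eqF// scale1r.
have := le_posZ a^-1 (a *: x); rewrite invr_gt0 => /(_ a0).
by rewrite scalerA mulVf ?gt_eqF// scale1r.
Qed.

Lemma rjoinE x y : riesz_join x y = x + rpos (y - x).
Proof.
have := rjoinDr (y - x) 0 x; rewrite subrK add0r addrC /rpos => <-.
by apply/eqP; rewrite eq_le !rjoin_le ?rle_joinl ?rle_joinr.
Qed.

Lemma rabs_ge0 x : 0 <= riesz_abs x.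
Proof.
have : 0 <= riesz_abs x + riesz_abs x.
  by rewrite -[leLHS](subrr x) rleD ?rle_joinl ?rle_joinr.
rewrite -(rleZ2 (a := 2^-1)) ?invr_gt0// scaler0 scalerDr.
by rewrite -scalerDl (_ : 2^-1 + 2^-1 = 1 :> R) ?scale1r//; lra.
Qed.

Lemma rabs_id x : 0 <= x -> riesz_abs x = x.
Proof.
move=> x0; apply/eqP; rewrite eq_le rle_joinl andbT rjoin_le//.
by apply: (@le_trans _ _ 0); rewrite // -oppr0 rleN2.
Qed.

Definition rmeet x y := x - rpos (x - y).

Lemma rmeet_lel x y : rmeet x y <= x.
Proof. by rewrite /rmeet rleBlDr -[leLHS]addr0 rleD ?rpos_ge0. Qed.

Lemma rmeet_ler x y : rmeet x y <= y.
Proof. by rewrite /rmeet rleBlDr addrC -rleBlDr rle_pos. Qed.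

Lemma rle_meet x y z : z <= x -> z <= y -> z <= rmeet x y.
Proof.
move=> zx zy; rewrite /rmeet rleBrDr addrC -rleBrDr rpos_le ?rsub_ge0//.
by rewrite rleD// rleN2.
Qed.

Lemma rsub_meet x y : y - rmeet x y = rpos (y - x).
Proof.
by rewrite /rmeet opprB addrA addrAC -{1}[y - x]rpos_posN opprB subrK.
Qed.

Lemma riesz_decomposition x y z : 0 <= x -> 0 <= y -> 0 <= z -> z <= x + y ->
  exists a b, [/\ 0 <= a, a <= x, 0 <= b, b <= y & z = a + b].
Proof.
move=> x0 y0 z0 zxy; exists (rmeet z x), (rpos (z - x)).
split; [exact: rle_meet|exact: rmeet_ler|exact: rpos_ge0| |by rewrite subrK].
by rewrite rpos_le// rleBlDr addrC.
Qed.

End RieszSpace.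

(** * Positive linear forms *)

Section PositiveForms.
Context (R : realType) (E : rieszSpaceType R).
Implicit Types (x y z : E) (f g h : E -> R).

Definition positive_form f := linear_form f /\ forall x, 0 <= x -> 0 <= f x.

Lemma positive_form_le f x y : positive_form f -> x <= y -> f x <= f y.
Proof.
move=> [lf pf]; rewrite -rsub_ge0 => /pf.
by rewrite linear_formB// subr_ge0.
Qed.

Lemma positive_form0 : positive_form (fun=> 0).
Proof. by split=> // a x y; rewrite mulr0 addr0. Qed.

Lemma positive_formD f g :
  positive_form f -> positive_form g -> positive_form (fun x => f x + g x).
Proof.
move=> [lf pf] [lg pg]; split=> [a x y|x x0]; first by rewrite lf lg; ring.
by rewrite addr_ge0 ?pf ?pg.
Qed.

Lemma positive_formZ (a : R) f :
  0 <= a -> positive_form f -> positive_form (fun x => a * f x).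
Proof.
move=> a0 [lf pf]; split=> [b x y|x x0]; first by rewrite lf; ring.
by rewrite mulr_ge0 ?pf.
Qed.

Lemma positive_form_sublinear f : positive_form f -> sublinear (f \o @rpos R E).
Proof.
move=> pf; have [lf _] := pf; split=> [a y a0|y z] /=.
  by rewrite rposZ// linear_formZ.
by rewrite -linear_formD//; apply: positive_form_le (rposD _ _).
Qed.

(** Hahn-Banach below y |-> f(y^+), touching at [x]: negative arguments give 0 <= g and positive
    ones g <= f. When f is a measure, its restriction to the set where x > 0 is such a g. *)
Lemma positive_form_split f x : positive_form f ->
  exists g, [/\ positive_form g, positive_form (fun y => f y - g y) &
    g x = f (rpos x)].
Proof.
move=> pf; have [lf f0] := pf.
have [g [lg gp gx]] := hahn_banach x (positive_form_sublinear pf).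
exists g; split=> //.
  split=> // y y0; rewrite -oppr_le0 -linear_formN//; apply: (le_trans (gp _)).
  by rewrite /= rpos_eq0 ?linear_form0// -oppr0 rleN2.
split=> [a y z|y y0].
- by rewrite lf lg; ring.
- by rewrite subr_ge0; have := gp y; rewrite /= rpos_id.
Qed.

(** Kantorovich extension along x = x^+ - x^-; additivity on the cone makes the value the same for
    every difference of positive elements representing x. *)
Lemma cone_form_extension (p : E -> R) :
  (forall x, 0 <= x -> 0 <= p x) ->
  (forall x y, 0 <= x -> 0 <= y -> p (x + y) = p x + p y) ->
  (forall a x, 0 <= a -> 0 <= x -> p (a *: x) = a * p x) ->
  exists2 f, positive_form f & forall x, 0 <= x -> f x = p x.
Proof.
move=> p0 pD pZ; pose f x := p (rpos x) - p (rpos (- x)).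
have fE a b : 0 <= a -> 0 <= b -> f (a - b) = p a - p b.
  move=> a0 b0; apply/eqP; rewrite /f subr_eq addrAC eq_sym subr_eq eq_sym.
  rewrite -!pD ?rpos_ge0//; apply/eqP; congr p.
  rewrite -[X in X + b](subrK (rpos (- (a - b)))) rpos_posN.
  by rewrite addrAC subrK.
have fp x : 0 <= x -> f x = p x.
  move=> x0; rewrite -[x in LHS]subr0 fE//.
  by have := pD 0 0 (lexx _) (lexx _); rewrite addr0; lra.
have fN x : f (- x) = - f x by rewrite /f opprK opprB.
have fZ a x : 0 <= a -> f (a *: x) = a * f x.
  move=> a0; rewrite -{1}[x]rpos_posN scalerBr.
  by rewrite fE ?riesz_scaler_ge0 ?rpos_ge0// !pZ ?rpos_ge0// /f; ring.
exists f => //; split=> [a x y|x x0]; last by rewrite fp ?p0.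
have -> : f (a *: x) = a * f x -> f (a *: x + y) = a * f x + f y.
- move=> <-; rewrite -{1}[a *: x]rpos_posN -{1}[y]rpos_posN addrACA -opprD.
  by rewrite fE ?raddr_ge0 ?rpos_ge0// !pD ?rpos_ge0// /f; ring.
- by [].
have [a0|/ltW a0] := leP 0 a; first exact: fZ.
by rewrite -[LHS]opprK -fN -scaleNr fZ ?oppr_ge0// mulNr opprK.
Qed.

(* The majorant is |g|, built as 2 g^+ - g so that only intervals [0, x] have
   to be decomposed. *)
Lemma order_bounded_form_majorant g : linear_form g ->
  (forall x, 0 <= x -> exists M, forall y, 0 <= y -> y <= x -> `|g y| <= M) ->
  exists h, [/\ positive_form h, forall y, 0 <= y -> `|g y| <= h y &
    forall x M, 0 <= x -> (forall y, 0 <= y -> y <= x -> `|g y| <= M) ->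
      h x <= 3 * M].
Proof.
move=> lg bg; pose A x := [set g y | y in [set y | 0 <= y /\ y <= x]].
have Ane x : 0 <= x -> A x !=set0 by move=> x0; exists (g 0); exists 0.
have Aub x : 0 <= x -> has_ubound (A x).
  move=> x0; have [M Mb] := bg x x0; exists M => _ [y [y0 yx] <-].
  exact: le_trans (ler_norm _) (Mb y y0 yx).
have Ale x y : 0 <= y -> y <= x -> g y <= sup (A x).
  move=> y0 yx; apply: ub_le_sup; last by exists y.
  by apply: Aub; exact: le_trans yx.
have [|x y x0 y0|a x a0 x0|f pf fE] := @cone_form_extension (fun x => sup (A x)).
- by move=> x x0; rewrite -(linear_form0 lg); exact: Ale.
- apply/eqP; rewrite eq_le; apply/andP; split.
    apply: ge_sup; first exact/Ane/raddr_ge0.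
    move=> _ [z [z0 zxy] <-].
    have [a [b [a0 ax b0 bx ->]]] := riesz_decomposition x0 y0 z0 zxy.
    by rewrite linear_formD//; apply: lerD; exact: Ale.
  rewrite -lerBrDr; apply: ge_sup; first exact: Ane.
  move=> _ [a [a0 ax] <-]; rewrite lerBrDr addrC -lerBrDr.
  apply: ge_sup; first exact: Ane.
  move=> _ [b [b0 bx] <-]; rewrite lerBrDr addrC -linear_formD//.
  by apply: Ale; [exact: raddr_ge0|exact: rleD].
- have le1 (b : R) z : 0 < b -> 0 <= z -> b * sup (A z) <= sup (A (b *: z)).
    move=> b0 z0; rewrite mulrC -ler_pdivlMr//; apply: ge_sup; first exact: Ane.
    move=> _ [y [y0 yz] <-]; rewrite ler_pdivlMr// mulrC -linear_formZ//.
    by apply: Ale; [exact: riesz_scaler_ge0 (ltW b0) _|rewrite rleZ2].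
  move: a0; rewrite le_eqVlt => /predU1P[<-|a0].
    rewrite scale0r mul0r; apply/eqP; rewrite eq_le.
    rewrite -[X in _ && (X <= _)](linear_form0 lg) Ale// andbT.
    apply: ge_sup; first exact: Ane.
    by move=> _ [y [y0 y0'] <-]; rewrite (@le_anti _ _ y 0) ?linear_form0// y0 y0'.
  apply/eqP; rewrite eq_le le1// andbT -ler_pdivrMl//.
  have := le1 a^-1 (a *: x); rewrite scalerA mulVf ?gt_eqF// scale1r; apply.
    by rewrite invr_gt0.
  exact: riesz_scaler_ge0 (ltW a0) x0.
have fg y : 0 <= y -> g y <= f y by move=> y0; rewrite fE// Ale.
exists (fun x => 2 * f x - g x); split=> [|y y0|x M x0 Mb].
- split=> [a x y|x x0]; first by rewrite pf.1 lg; ring.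
  by have := fg x x0; have := pf.2 x x0; lra.
- by rewrite ler_norml; have := fg y y0; have := pf.2 y y0; lra.
have : f x <= M.
  rewrite fE//; apply: ge_sup; first exact: Ane.
  by move=> _ [y [y0 yx] <-]; exact: le_trans (ler_norm _) (Mb y y0 yx).
by have := Mb x x0 (lexx _); rewrite ler_norml; lra.
Qed.

End PositiveForms.

(** * Contraction forms and the weak topology *)

Section ContractionForms.
Context (R : realType) (X : normedModType R).
Implicit Types (x y z : X) (f : X -> R).

Definition contraction_form f := linear_form f /\ forall x, `|f x| <= `|x|.

Lemma norm_sublinear : sublinear (fun x : X => `|x|).
Proof. by split=> [a y a0|]; [rewrite normrZ ger0_norm|exact: ler_normD]. Qed.

Lemma contraction_form_le f : linear_form f -> (forall x, f x <= `|x|) ->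
  contraction_form f.
Proof.
move=> lf fx; split=> // x; rewrite ler_norml fx andbT lerNl -linear_formN//.
by rewrite -normrN fx.
Qed.

Lemma norming_form x : exists2 f, contraction_form f & f x = `|x|.
Proof.
have [f [lf fx f1]] := hahn_banach x norm_sublinear.
by exists f => //; exact: contraction_form_le.
Qed.

Lemma norm_le_forms x (c : R) :
  (forall f, contraction_form f -> `|f x| <= c) -> `|x| <= c.
Proof.
have [f cf fx] := norming_form x => /(_ f cf); apply: le_trans.
by rewrite fx ler_norm.
Qed.

Lemma contraction_form_continuous_linear f :
  contraction_form f -> f \in @continuous_linear R X.
Proof.
move=> [lf cf]; apply/asboolP; split=> //.
move=> x; apply/(@cvgrPdist_le _ R^o) => e e0; near=> y.
rewrite -(linear_formB _ _ lf); apply: (le_trans (cf _)).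
by near: y; exact: cvgr_dist_le.
Unshelve. all: by end_near. Qed.

Definition contraction_dual f (cf : contraction_form f) : dual X :=
  Dual (contraction_form_continuous_linear cf).

(** Weak convergence can thus be tested on the dual unit ball, where estimates are uniform. *)
Lemma dual_contraction (g : dual X) : exists2 c : R, 0 < c &
  contraction_form (fun x => c^-1 * g x).
Proof.
have cg := @dual_continuous R X g.
have /linear_bounded_continuous/linear_boundedP gb :
  continuous (g : {linear X -> R^o}) by exact: cg.
have [c [c0 cP]] : exists c : R, 0 < c /\ forall x, `|g x| <= c * `|x|.
  near (+oo : set_system R) => c; exists c; split.
    by near: c; exact: nbhs_pinfty_gt.
  by near: c.
exists c => //; split=> [a x y|x].
  by rewrite linearP [_ + _]/= mulrDr [_ *: _]/= mulrCA.
by rewrite normrM gtr0_norm ?invr_gt0// ler_pdivrMl.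
Unshelve. all: by end_near. Qed.

End ContractionForms.

Section WeakTopology.
Context (R : realType) (X : completeNormedModType R).
Implicit Types (z : X).

Lemma cvg_initial (S : choiceType) (T : topologicalType) (f : S -> T)
    (F : set_system S) (s : S) : Filter F ->
  f @ F --> f s -> F --> (s : initial_topology f).
Proof.
move=> FF cf A /= [_ [[B Bop <-] Bfs sBfA]].
have : nbhs (f s) B by rewrite nbhsE; exists B.
by move=> /cf FB; rewrite nbhs_filterE; exact: filterS sBfA FB.
Qed.

Lemma weak_cvg (F : set_system X) z : Filter F ->
  (forall f : dual X, (f : X -> R^o) @ F --> (f z : R^o)) ->
  F --> (z : weak_topology X).
Proof.
move=> FF cF; apply: (@cvg_initial X {ptws dual X -> R^o}
  (fun x f => f x) F z FF); apply/cvg_sup => f.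
exact: (@cvg_initial _ _ (@proj (dual X) (fun=> R^o) f) _ _ _ (cF f)).
Qed.

Lemma weak_eval_continuous (f : dual X) :
  continuous (f : weak_topology X -> R^o).
Proof.
move=> z; apply: (@continuous_comp _ _ _
  ((fun x f => f x) : weak_topology X -> {ptws dual X -> R^o}) (proj f)).
  exact: initial_continuous.
exact: proj_continuous.
Qed.

Lemma weak_hausdorff : hausdorff_space (weak_topology X).
Proof.
move=> x y xy; apply/eqP; rewrite -subr_eq0 -normr_le0 leNgt; apply/negP => e0.
have [f cf fxy] := norming_form (x - y : X).
have nb (z : X) : nbhs (z : weak_topology X)
    [set w | `|f z - f w| < `|(x - y : X)| / 2].
  have r0 : 0 < `|(x - y : X)| / 2 by rewrite divr_gt0.
  have := @weak_eval_continuous (contraction_dual cf) z _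
    (@nbhsx_ballx _ R^o (f z) _ r0).
  apply: (@filterS _ _ (nbhs_filter (z : weak_topology X))) => w.
  by rewrite -ball_normE.
have [w [/= xw yw]] := xy _ _ (nb x) (nb y).
have : `|f x - f y| < `|(x - y : X)|.
  rewrite [ltRHS]splitr; apply: le_lt_trans (ltrD xw yw).
  by rewrite [`|f y - _|]distrC; apply: ler_distD.
by rewrite -(linear_formB _ _ cf.1) fxy normr_id ltxx.
Qed.

End WeakTopology.

(** * A criterion for relative weak compactness *)

Section Criterion.
Context (R : realType) (V : lmodType R) (X : completeNormedModType R).

Definition midpoint_convex (C : set V) :=
  forall x y, C x -> C y -> C (2^-1 *: (x + y)).

Lemma ultra_bounded_cvg (T : Type) (F : set_system T) (g : T -> R) (M : R) :
  UltraFilter F -> F [set t | `|g t| <= M] -> exists l : R, g @ F --> l.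
Proof.
move=> UF FM; have FF : ProperFilter (g @ F) by exact: fmap_proper_filter.
have [|l [_ cl]] := @segment_compact R (- M) M _ FF.
  rewrite nbhs_filterE /fmap /=; apply: filterS FM => t.
  by rewrite /= in_itv/= ler_norml.
exists l => U Ul; have [//|FU] := in_ultra_setVsetC (g @^-1` U) UF.
have [t [+ Ut]] := cl _ _ (FU : (g @ F) (~` U)) Ul.
by move=> /(_ Ut).
Qed.

(** [Q] acts as a squared Hilbert norm: near-minimisers over a convex set are close to each other,
    here only after [T] and up to [e]. *)
Lemma image_weakly_compact (T : {linear V -> X}) (D : set V) :
  midpoint_convex D ->
  (exists M : R, forall x, D x -> `|T x| <= M) ->
  (forall e : R, 0 < e -> exists (Q : V -> R) (W d : R),
    [/\ 0 < d, forall x, D x -> `|Q x| <= W &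
      forall x y, D x -> D y ->
        (Q x + Q y) / 2 - Q (2^-1 *: (x + y)) <= d -> `|T x - T y| <= e]) ->
  relatively_weakly_compact (T @` D).
Proof.
move=> Dconv [M TM] DQ.
(* The norm closure of T(D): it contains the norm limit built below and, once compact, is weakly
   closed. *)
pose K := [set z : X | forall e : R, 0 < e -> exists2 x, D x & `|z - T x| <= e].
have KM z : K z -> `|z| <= M + 1.
  move=> /(_ 1 ltr01)[x Dx zx]; rewrite -[z](subrK (T x)) addrC.
  by apply: (le_trans (ler_normD _ _)); exact: lerD (TM _ Dx) zx.
suff Kc : compact (K : set (weak_topology X)).
  have Kcl := compact_closed (@weak_hausdorff R X) Kc.
  apply: subclosed_compact Kc _; first exact: closed_closure.
  rewrite [X in _ `<=` X]((closure_id _).1 Kcl); apply: closureS.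
  by move=> _ [x Dx <-] e e0; exists x => //; rewrite subrr normr0 ltW.
rewrite compact_ultra => F UF FK.
have PF : ProperFilter F := ultra_proper.
have approx e : 0 < e -> exists2 y, D y & forall f (l : R),
    contraction_form f -> f @ F --> l -> `|f (T y) - l| <= e.
  move=> e0; have e30 : 0 < e / 3 by rewrite divr_gt0.
  have /choice[r rP] (z : X) : exists x, K z -> D x /\ `|z - T x| <= e / 3.
    have [Kz|nKz] := pselect (K z); last by exists 0.
    by have [x Dx zx] := Kz _ e30; exists x.
  have [Q [W [d [d0 QW Qd]]]] := DQ _ e30.
  (* Convex sets charged by the ultrafilter through the approximate preimages [r]; [C] below nearly
     attains the supremum of the infima of [Q]. *)
  pose A C := [/\ midpoint_convex C, C `<=` D & F (r @^-1` C)].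
  have AD : A D by split=> //; apply: filterS FK => z /rP[].
  have Ane C : A C -> [set Q x | x in C] !=set0.
    by move=> [_ _ /filter_ex[z Cz]]; exists (Q (r z)); exists (r z).
  have Alb C : A C -> has_lbound [set Q x | x in C].
    move=> [_ CD _]; exists (- W) => _ [x /CD/QW + <-].
    by rewrite ler_norml => /andP[].
  pose B := [set inf [set Q x | x in C] | C in A].
  have Bub : has_ubound B.
    exists W => _ [C AC <-]; have [_ [x Cx _]] := Ane _ AC.
    apply: (@le_trans _ _ (Q x)); first by apply: ge_inf; [exact: Alb|exists x].
    by apply: (le_trans (ler_norm _)); apply: QW; case: AC => _ + _; exact.
  have B0 : B !=set0 by exists (inf [set Q x | x in D]); exists D.
  have d20 : 0 < d / 2 by rewrite divr_gt0.
  have [_ [C AC <-] Cm] := sup_adherent d20 (conj B0 Bub).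
  have near_inf C' : A C' -> exists2 x, C' x & Q x < sup B + d / 2.
    move=> AC'; have [_ [x Cx <-] xC] :=
      inf_adherent d20 (conj (Ane _ AC') (Alb _ AC')).
    exists x => //; apply: (lt_le_trans xC); rewrite lerD2r.
    by apply: ub_le_sup => //; exists C'.
  have [y Cy Qy] := near_inf _ AC.
  have [Cconv CD FC] := AC.
  exists y => [|f l cf fl]; first exact: CD.
  (* [y] is fixed before [f]. The slice stays in [A] since T(r z) is within e / 3 of z and f(z)
     within e / 3 of [l]. For a near-minimiser [y'] of the slice, [Q] is below [sup B + d / 2] at
     [y] and [y'], but above [sup B - d / 2] at their midpoint, which lies in [C]. *)
  pose C1 := C `&` [set x | `|f (T x) - l| <= 2 * e / 3].
  have AC1 : A C1.
    split.
    - move=> u v [Cu fu] [Cv fv]; split; first exact: Cconv.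
      move: fu fv => /=; rewrite linearZ linearD (linear_formZ _ _ cf.1).
      by rewrite (linear_formD _ _ cf.1) !ler_norml; lra.
    - by move=> u [/CD].
    near=> z; split; first by near: z.
    have Kz : K z by near: z.
    have : `|l - f z| <= e / 3 by near: z; exact: (@cvgr_dist_le _ R^o).
    have [_ zr] := rP _ Kz.
    have := le_trans (cf.2 _) zr; rewrite (linear_formB _ _ cf.1) /=.
    by rewrite !ler_norml; lra.
  have [y' [Cy' fy'] Qy'] := near_inf _ AC1.
  have mid : inf [set Q x | x in C] <= Q (2^-1 *: (y + y')).
    by apply: ge_inf; [exact: Alb|exists (2^-1 *: (y + y')) => //; exact: Cconv].
  have : `|T y - T y'| <= e / 3.
    by apply: Qd; [exact: CD|exact: CD|lra].
  move/(le_trans (cf.2 _)); rewrite (linear_formB _ _ cf.1).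
  by move: fy' => /=; rewrite !ler_norml; lra.
have lim_ex f : contraction_form f -> exists l : R, f @ F --> l.
  move=> cf; apply: (@ultra_bounded_cvg _ _ _ (M + 1)) => //.
  by apply: filterS FK => z /KM; exact: le_trans (cf.2 _).
have [r_ r_gt0 r_small] : exists2 r_ : nat -> R, forall n, 0 < r_ n &
    forall e, 0 < e -> \forall n \near \oo, r_ n <= e.
  exists (fun n => n.+1%:R^-1) => [n|e e0]; first by rewrite invr_gt0.
  have := @cvg_harmonic R => /cvgrPdist_le/(_ e e0).
  by apply: filterS => n /=; rewrite sub0r normrN; apply: le_trans (ler_norm _).
have /choice[y_ yP] (n : nat) : exists y, D y /\ forall f (l : R),
    contraction_form f -> f @ F --> l -> `|f (T y) - l| <= r_ n.
  by have [y Dy yn] := approx _ (r_gt0 n); exists y.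
have ycauchy m n : `|T (y_ m) - T (y_ n)| <= r_ m + r_ n.
  apply: norm_le_forms => f cf; have [l fl] := lim_ex _ cf.
  rewrite (linear_formB _ _ cf.1).
  have := (yP m).2 f l cf fl; have := (yP n).2 f l cf fl.
  by rewrite !ler_norml; lra.
have cy : cvg (T (y_ n) @[n --> \oo]).
  apply/cauchy_cvgP/cauchy_exP => e e0.
  have e20 : 0 < e / 4 by rewrite divr_gt0.
  have [N _ NP] := r_small _ e20; exists (T (y_ N)); exists N => // n Nn /=.
  rewrite -ball_normE/=; apply: le_lt_trans (ycauchy _ _) _.
  by have := NP _ (leqnn N); have := NP _ Nn; rewrite /=; lra.
set z := lim (T (y_ n) @[n --> \oo]) in cy.
have fz f (l : R) : contraction_form f -> f @ F --> l -> f z = l.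
  move=> cf fl; apply/eqP; rewrite -subr_eq0 -normr_le0.
  apply/ler_addgt0Pl => e e0; rewrite addr0.
  near \oo => n.
  have : `|z - T (y_ n)| <= e / 2.
    by near: n; apply: cvgr_dist_le; [exact: cy|rewrite divr_gt0].
  move/(le_trans (cf.2 _)); rewrite (linear_formB _ _ cf.1).
  have : r_ n <= e / 2 by near: n; apply: r_small; rewrite divr_gt0.
  by have := (yP n).2 f l cf fl; rewrite !ler_norml; lra.
exists z; split=> [e e0|].
  near \oo => n; exists (y_ n); first exact: (yP n).1.
  apply: norm_le_forms => f cf; have [l fl] := lim_ex _ cf.
  rewrite (linear_formB _ _ cf.1) (fz f l)// distrC.
  apply: le_trans ((yP n).2 f l cf fl) _.
  by near: n; exact: r_small.
apply: weak_cvg => g; have [c c0 cg] := dual_contraction g.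
have [l fl] := lim_ex _ cg.
have gE : (g : X -> R^o) = (fun x => c * (c^-1 * g x)).
  by apply/funext => x; rewrite mulrA divff ?gt_eqF// mul1r.
have -> : (g z : R^o) = c * l by rewrite -(fz _ _ cg fl) mulrA divff ?gt_eqF// mul1r.
by rewrite gE; apply: (@cvgMr _ _ _ _ _ c) fl.
Unshelve. all: by end_near. Qed.

End Criterion.

(** * Operators that converge along increasing sequences *)

Section Sequences.
Context (R : realType) (E : rieszSpaceType R) (X : completeNormedModType R).
Context (T : {linear E -> X}).
Implicit Types (x y z : E) (P : set E).

Lemma rincreasing (x_ : nat -> E) : (forall n, x_ n <= x_ n.+1) ->
  forall m n, (m <= n)%N -> x_ m <= x_ n.
Proof.
move=> x1; apply: (@homo_leq _ x_ (fun u v => u <= v)) => // u v w.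
exact: le_trans.
Qed.

Lemma cvg_increments (u_ : nat -> X) (e : R) : cvg (u_ n @[n --> \oo]) ->
  0 < e -> exists N, forall m n, (N <= m)%N -> (N <= n)%N ->
    `|u_ m - u_ n| <= e.
Proof.
move=> cu e0; have e20 : 0 < e / 2 by rewrite divr_gt0.
have ul : u_ n @[n --> \oo] --> lim (u_ n @[n --> \oo]) by exact: cu.
have [N _ NP] : \forall n \near \oo, `|lim (u_ n @[n --> \oo]) - u_ n| <= e / 2.
  exact: cvgr_dist_le ul _ e20.
exists N => m n Nm Nn.
rewrite -(subrK (lim (u_ n @[n --> \oo])) (u_ m)) -addrA [e]splitr.
apply: (le_trans (ler_normD _ _)); apply: lerD; last exact: NP.
by rewrite distrC; exact: NP.
Qed.

Definition converges_on P := forall x_ : nat -> E,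
  (forall n, P (x_ n)) -> (forall n, x_ n <= x_ n.+1) ->
  cvg (T (x_ n) @[n --> \oo]).

Lemma expr2V_gt0 n : 0 < (2^-1 : R) ^+ n.
Proof. by rewrite exprn_gt0// invr_gt0. Qed.

Lemma sum_expr2V k n :
  \sum_(i < n) (2^-1 : R) ^+ (k + i).+1 = 2^-1 ^+ k - 2^-1 ^+ (k + n).
Proof.
elim: n => [|n IH]; first by rewrite big_ord0 addn0 subrr.
by rewrite big_ord_recr/= IH addnS !exprS; lra.
Qed.

(** Points with |T x_n| > 2^(n+1), weighted by 2^-(n+1), would sum to an increasing sequence of [P]
    whose image moves by more than 1 at every step. *)
Lemma converges_on_bounded P :
  (forall x, P x -> 0 <= x) -> P 0 -> midpoint_convex P -> converges_on P ->
  exists M : R, forall x, P x -> `|T x| <= M.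
Proof.
move=> Pge0 P0 Pm Pc; apply: contrapT => /forallNP unb.
have /choice[x_ xP] (n : nat) : exists x, P x /\ 2 ^+ n.+1 < `|T x|.
  have /existsNP[x /not_implyP[Px /negP]] := unb (2 ^+ n.+1).
  by rewrite -ltNge; exists x.
pose c_ n := \sum_(k < n) (2^-1 ^+ k.+1 : R) *: x_ k.
have cS n : c_ n.+1 = c_ n + (2^-1 ^+ n.+1 : R) *: x_ n.
  by rewrite /c_ big_ord_recr.
(* Nested midpoints: replacing [y] by the midpoint of x_n and [y] passes from n to n + 1. *)
have cP n y : P y -> P (c_ n + (2^-1 ^+ n : R) *: y).
  elim: n y => [|n IH] y Py; first by rewrite /c_ big_ord0 add0r scale1r.
  have := IH _ (Pm _ _ (xP n).1 Py); congr (P _).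
  by rewrite cS -addrA exprSr scalerA scalerDr.
have [|N NP] := @cvg_increments (T \o c_) 1 _ ltr01.
  apply: Pc => n; first by have := cP n 0 P0; rewrite scaler0 addr0.
  rewrite cS -[leLHS]addr0 rleD// riesz_scaler_ge0 ?(ltW (expr2V_gt0 _))//.
  exact: Pge0 (xP n).1.
have := NP N.+1 N (leqnSn _) (leqnn _).
rewrite /= cS linearD addrC addKr linearZ normrZ gtr0_norm ?expr2V_gt0//.
apply/negP; rewrite -ltNge; have := (xP N).2.
by rewrite exprVn ltr_pdivlMl ?exprn_gt0// mulr1.
Qed.

(** Bounds the supremum of |T y| over the order interval [0, x]. Unlike |T x|, this supremum is
    monotone, and it is subadditive on the cone by Riesz decomposition. *)
Definition small_below (c : R) x := forall y, 0 <= y -> y <= x -> `|T y| <= c.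

Lemma small_below_le c x y : x <= y -> small_below c y -> small_below c x.
Proof. by move=> xy sy z z0 zx; apply: sy => //; exact: le_trans xy. Qed.

Lemma small_below_leC c d x : c <= d -> small_below c x -> small_below d x.
Proof. by move=> cd sx z z0 zx; apply: le_trans cd; exact: sx. Qed.

Lemma small_belowD c d x y : 0 <= x -> 0 <= y ->
  small_below c x -> small_below d y -> small_below (c + d) (x + y).
Proof.
move=> x0 y0 sx sy z z0 zxy.
have [a [b [a0 ax b0 bx ->]]] := riesz_decomposition x0 y0 z0 zxy.
by rewrite linearD (le_trans (ler_normD _ _))// lerD ?sx ?sy.
Qed.

(** Otherwise pieces below successive differences of the x_n, each with image of norm above [e], add
    up to an increasing sequence; its partial sums stay below terms x_(k n), hence in [P], and their
    images are not Cauchy. *)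
Lemma increasing_cauchy_below P (x_ : nat -> E) (e : R) :
  (forall x, P x -> 0 <= x) ->
  (forall x y, 0 <= y -> y <= x -> P x -> P y) -> converges_on P ->
  (forall n, P (x_ n)) -> (forall n, x_ n <= x_ n.+1) -> 0 < e ->
  exists N, forall n, (N <= n)%N -> small_below e (x_ n - x_ N).
Proof.
move=> Pge0 Pd Pc xP /rincreasing xmono e0; apply: contrapT => /forallNP unc.
have /choice[g gP] (N : nat) : exists p : nat * E,
    [/\ (N <= p.1)%N, 0 <= p.2, p.2 <= x_ p.1 - x_ N & e < `|T p.2|].
  have /existsNP[n /not_implyP[Nn /existsNP[y /not_implyP[y0]]]] := unc N.
  by move=> /not_implyP[yx /negP]; rewrite -ltNge => ye; exists (n, y).
pose k_ n := iter n (fun N => (g N).1) 0.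
pose z_ n := \sum_(i < n) (g (k_ i)).2.
have zS n : z_ n.+1 = z_ n + (g (k_ n)).2 by rewrite /z_ big_ord_recr.
have z0 n : 0 <= z_ n by apply: rsumr_ge0 => i _; case: (gP (k_ i)).
have zx n : z_ n <= x_ (k_ n).
  elim: n => [|n IH]; first by rewrite /z_ big_ord0 Pge0.
  have [_ _ gx _] := gP (k_ n).
  by rewrite zS (le_trans (rleD IH gx))//= addrC subrK.
have [|N NP] := @cvg_increments (T \o z_) e _ e0.
  apply: Pc => n; first exact: Pd (z0 n) (zx n) (xP _).
  by rewrite zS -[leLHS]addr0 rleD//; case: (gP (k_ n)).
have := NP N.+1 N (leqnSn _) (leqnn _).
rewrite /= zS linearD addrC addKr; apply/negP; rewrite -ltNge.
by case: (gP (k_ N)).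
Qed.

Fixpoint join_block (x_ : nat -> E) n m : E :=
  if m is m'.+1 then riesz_join (join_block x_ n m') (x_ (n + m)%N) else x_ n.

Lemma join_block_ub (x_ : nat -> E) n m i :
  (i <= m)%N -> x_ (n + i)%N <= join_block x_ n m.
Proof.
elim: m => [|m IH]; first by rewrite leqn0 => /eqP ->; rewrite addn0.
rewrite leq_eqVlt => /predU1P[->|]; first exact: rle_joinr.
by rewrite ltnS => /IH im; apply: le_trans im (rle_joinl _ _).
Qed.

Lemma join_block_le (x_ : nat -> E) n m z :
  (forall i, (i <= m)%N -> x_ (n + i)%N <= z) -> join_block x_ n m <= z.
Proof.
elim: m => [|m IH] xz; first by have := xz 0 (leqnn _); rewrite addn0.
by apply: rjoin_le; [apply: IH => i im; apply: xz; exact: leqW|exact: xz].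
Qed.

End Sequences.

(** * Absolute continuity *)

Section AbsoluteContinuity.
Context (R : realType) (E : rieszSpaceType R) (X : completeNormedModType R).
Context (T : {linear E -> X}) (P : set E).
Hypothesis Pge0 : forall x, P x -> 0 <= x.
Hypothesis P_down : forall x y, 0 <= y -> y <= x -> P x -> P y.
Hypothesis P_join : forall x y, P x -> P y -> P (riesz_join x y).
Hypothesis P_cvg : converges_on T P.
Hypothesis T_order_bounded : forall x, 0 <= x ->
  exists M : R, forall y, 0 <= y -> y <= x -> `|T y| <= M.
Hypothesis T_bounded : exists M : R, forall x, P x -> `|T x| <= M.

Definition bounded_form (phi : E -> R) :=
  positive_form phi /\ exists M, forall x, P x -> phi x <= M.

(** [psi] is the modulus of f o T for a norming [f]. It is bounded on [P] because intervals below
    points of [P] stay in [P], where [T] is bounded. *)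
Lemma norming_majorant x : exists psi : E -> R, bounded_form psi /\
  exists f : X -> R, [/\ contraction_form f, f (T x) = `|T x| &
    forall y, 0 <= y -> `|f (T y)| <= psi y].
Proof.
have [f cf fx] := norming_form (T x).
have lfT : linear_form (f \o T) by move=> a u v; rewrite /= linearP cf.1.
have [x' x'0|psi [ppsi fpsi psib]] := order_bounded_form_majorant lfT.
  have [M TM] := T_order_bounded x'0; exists M => y y0 yx.
  by apply: (le_trans (cf.2 _)); exact: TM.
exists psi; split; last by exists f.
split=> //; have [M TM] := T_bounded; exists (3 * M) => y Py.
apply: psib; first exact: Pge0.
move=> z z0 zy; apply: (le_trans (cf.2 _)); apply: TM; exact: P_down Py.
Qed.

Lemma join_block_in (x_ : nat -> E) n m :
  (forall i, P (x_ i)) -> P (join_block x_ n m).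
Proof. by move=> xP; elim: m => //= m IH; exact: P_join. Qed.

(* The blocks x_n \/ .. \/ x_(n + m) increase with m inside P, so a fixed
   choice t_n of m is an approximate supremum of the tail at n. *)
Lemma approximate_limsup (x_ : nat -> E) (e : R) : (forall n, P (x_ n)) -> 0 < e ->
  exists (r_ : nat -> E) (m_ : nat -> nat),
    [/\ forall n, 0 <= r_ n, forall n, r_ n.+1 <= r_ n,
        forall n, r_ n <= join_block x_ n (m_ n) &
        forall n, small_below T e (join_block x_ n (m_ n) - r_ n)].
Proof.
move=> xP e0.
have tP n m : P (join_block x_ n m) by exact: join_block_in.
have /choice[m_ mP] (n : nat) : exists N, forall m, (N <= m)%N ->
    small_below T (e * 2^-1 ^+ n.+1) (join_block x_ n m - join_block x_ n N).
  apply: (@increasing_cauchy_below _ _ _ _ P) => // [m|].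
    exact: rle_joinl.
  by rewrite mulr_gt0// expr2V_gt0.
pose t_ n := join_block x_ n (m_ n).
pose r_ := fix r n := if n is n'.+1 then rmeet (r n') (t_ n) else t_ 0.
have r0 n : 0 <= r_ n.
  by elim: n => [|n IH]; [|apply: rle_meet => //]; exact: Pge0 (tP _ _).
have rt n : r_ n <= t_ n by case: n => // n; exact: rmeet_ler.
(* One longer block starting at [n] dominates both [t_ n] and [t_ n.+1], and it exceeds [t_ n] by
   little. *)
have step n : small_below T (e * 2^-1 ^+ n.+1) (rpos (t_ n.+1 - t_ n)).
  pose m := maxn (m_ n) (m_ n.+1).+1.
  apply: small_below_le (mP n m (leq_maxl _ _)).
  apply: rpos_le; last first.
    rewrite rsub_ge0; apply: join_block_le => i im.
    by apply: join_block_ub; rewrite (leq_trans im)// leq_maxl.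
  apply: riesz_leD2r; apply: join_block_le => i im.
  by rewrite addSnnS; apply: join_block_ub; rewrite (leq_trans _ (leq_maxr _ _)).
exists r_, m_; split=> // n; first exact: rmeet_lel.
suff: small_below T (\sum_(i < n) e * 2^-1 ^+ i.+1) (t_ n - r_ n).
  apply: small_below_leC; rewrite -mulr_sumr.
  have := sum_expr2V R 0 n; under eq_bigr do rewrite add0n.
  move=> ->; rewrite expr0 ler_piMr ?(ltW e0)//.
elim: n => [|n IH].
  rewrite big_ord0 subrr => y y0 y0'.
  by rewrite (@le_anti _ _ y 0) ?y0 ?y0'// linear0 normr0.
rewrite big_ord_recr/=.
have tr0 : 0 <= t_ n - r_ n by rewrite rsub_ge0.
apply: small_below_le (small_belowD tr0 (rpos_ge0 _) IH (step n)).
(* The new gap is the positive part of t_(n+1) - r_n, at most the old gap plus the excess of t_(n+1)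
   over t_n. *)
rewrite rsub_meet (_ : t_ n.+1 - r_ n = (t_ n - r_ n) + (t_ n.+1 - t_ n)).
  by rewrite -[X in _ <= X + _](rpos_id tr0); exact: rposD.
by rewrite [RHS]addrC addrA subrK.
Qed.

(** If no control form exists, then neither is any multiple of the sum of the majorants psi_i found
    so far. This gives points x_n with |T x_n| > e at which all earlier psi_i are at most eta 2^-n.
    An approximate lim sup splits some x_N into a part with small image and a part below the later
    points, where psi_N is small. *)
Lemma dominating_form (e : R) : 0 < e ->
  exists2 phi, bounded_form phi &
    forall x, P x -> phi x <= 1 -> `|T x| <= e.
Proof.
move=> e0; apply: contrapT => nphi; pose eta := e / 4.
have eta0 : 0 < eta by rewrite divr_gt0.
have /choice[g gP] (phi : E -> R) : exists q : E * (E -> R), bounded_form phi ->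
    [/\ P q.1, phi q.1 <= 1, e < `|T q.1|, bounded_form q.2 &
      exists f : X -> R, [/\ contraction_form f, f (T q.1) = `|T q.1| &
        forall y, 0 <= y -> `|f (T y)| <= q.2 y]].
  have [bphi|nb] := pselect (bounded_form phi); last by exists (0, phi).
  have /existsNP[x /not_implyP[Px /not_implyP[phix /negP]]] :
      ~ forall x, P x -> phi x <= 1 -> `|T x| <= e.
    by move=> h; apply: nphi; exists phi.
  rewrite -ltNge => Tx; have [psi [bpsi psif]] := norming_majorant x.
  by exists (x, psi).
have bZ (a : R) phi : 0 <= a -> bounded_form phi ->
    bounded_form (fun x => a * phi x).
  move=> a0 [pphi [M phiM]]; split; first exact: positive_formZ.
  by exists (a * M) => x Px; rewrite ler_wpM2l ?phiM.
have bD phi psi : bounded_form phi -> bounded_form psi ->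
    bounded_form (fun x => phi x + psi x).
  move=> [pphi [M phiM]] [ppsi [N psiN]]; split; first exact: positive_formD.
  by exists (M + N) => x Px; rewrite lerD ?phiM ?psiN.
(* With this factor, [a_ n * Phi n x <= 1] means that Phi n x is at most eta 2^-n. *)
pose a_ n : R := (eta * 2^-1 ^+ n)^-1.
have a0 n : 0 < a_ n by rewrite invr_gt0 mulr_gt0 ?expr2V_gt0.
pose Phi := fix Phi n : E -> R := if n is n'.+1
  then fun x => Phi n' x + (g (fun x => a_ n' * Phi n' x)).2 x else fun=> 0.
pose q_ n := g (fun x => a_ n * Phi n x).
have bPhi n : bounded_form (Phi n).
  elim: n => [|n IH]; first by split; [exact: positive_form0|exists 0].
  apply: bD => //; have := gP (fun x => a_ n * Phi n x).
  by case=> //; apply: bZ => //; exact: ltW.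
have qP n := gP _ (bZ _ _ (ltW (a0 n)) (bPhi n)).
have phi_small i n : (i < n)%N -> (q_ i).2 (q_ n).1 <= eta * 2^-1 ^+ n.
  move=> lt_in; have [Px Phix _ _ _] := qP n; rewrite -/(q_ n) in Px Phix.
  have x0 := Pge0 Px.
  apply: (@le_trans _ _ (Phi n (q_ n).1)); last first.
    by move: Phix; rewrite ler_pdivrMl ?mulr1// mulr_gt0 ?expr2V_gt0.
  elim: n (q_ n).1 x0 lt_in {Px Phix} => // n IH x x0.
  rewrite ltnS leq_eqVlt => /predU1P[->|lt_in] /=.
    by rewrite -/(q_ n) lerDr; apply: (bPhi n).1.2.
  rewrite (le_trans (IH _ x0 lt_in))// lerDl.
  by case: (qP n) => _ _ _ [[_ +] _] _; exact.
pose x_ n := (q_ n).1.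
have xP n : P (x_ n) by case: (qP n).
have [r_ [m_ [r0 rS rt tr]]] := approximate_limsup xP eta0.
have r_le n : r_ n <= r_ 0 by elim: n => // n; exact: le_trans (rS n).
(* The r_n decrease, so the hereditary Cauchy property is applied to the increasing sequence r_0 -
   r_n. *)
have [|n|N NP] := @increasing_cauchy_below _ _ _ T P (fun n => r_ 0 - r_ n)
  eta Pge0 P_down P_cvg _ _ eta0.
- move=> n; apply: P_down (join_block_in 0 (m_ 0) xP); first by rewrite rsub_ge0.
  by apply: le_trans (rt 0); rewrite rleBlDr -[leLHS]addr0 rleD.
- by rewrite rleD// rleN2.
have small_r : small_below T eta (r_ N - r_ N.+1).
  have := NP N.+1 (leqnSn N); congr small_below.
  by rewrite opprB addrC addrA subrK.
have [_ _ Tx [[lpsi psi0] _] [f [cf fx fpsi]]] := qP N.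
rewrite -/(q_ N) -/(x_ N) in Tx lpsi psi0 fx fpsi *.
(* x_N = w + v, where w <= (t_N - r_N) + (r_N - r_(N+1)) costs 2 eta and v, below a sum of later
   points, costs eta: in total 3 eta < e. *)
pose w := rpos (x_ N - r_ N.+1); pose v := rmeet (x_ N) (r_ N.+1).
have Tw : `|T w| <= eta + eta.
  have h1 : 0 <= r_ N - r_ N.+1 by rewrite rsub_ge0.
  have h2 : 0 <= join_block x_ N (m_ N) - r_ N by rewrite rsub_ge0.
  apply: (small_belowD h2 h1 (tr N) small_r); first exact: rpos_ge0.
  rewrite addrA subrK; apply: rpos_le; last by rewrite rsub_ge0 (le_trans (rS N)).
  apply: riesz_leD2r; have := join_block_ub x_ N (leq0n (m_ N)).
  by rewrite addn0.
have v0 : 0 <= v by apply: rle_meet => //; exact: Pge0.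
have psiv : (q_ N).2 v <= eta.
  pose m := m_ N.+1; have vsum : v <= \sum_(i < m.+1) x_ (N.+1 + i)%N.
    apply: (le_trans (rmeet_ler _ _)); apply: (le_trans (rt N.+1)).
    apply: join_block_le => i im; rewrite (bigD1 (inord i))//= inordK ?ltnS//.
    by rewrite -[leLHS]addr0 rleD// rsumr_ge0// => j _; exact: Pge0.
  apply: le_trans (positive_form_le (conj lpsi psi0) vsum) _.
  rewrite linear_form_sum//.
  apply: (@le_trans _ _ (\sum_(i < m.+1) eta * 2^-1 ^+ (N + i).+1)).
    by apply: ler_sum => i _; apply: phi_small; rewrite addSn ltnS leq_addr.
  rewrite -mulr_sumr sum_expr2V ler_piMr ?(ltW eta0)// lerBlDr.
  apply: (@le_trans _ _ 1).
    by rewrite exprn_ile1// ?invr_ge0// invf_le1// ler1n.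
  by rewrite lerDl ltW// expr2V_gt0.
have : `|T (x_ N)| <= `|T w| + (q_ N).2 v.
  rewrite -fx -[X in f (T X)](_ : w + v = x_ N); last by rewrite addrC subrK.
  rewrite linearD (linear_formD _ _ cf.1); apply: lerD.
    exact: le_trans (ler_norm _) (cf.2 _).
  exact: le_trans (ler_norm _) (fpsi _ v0).
by move: Tx Tw psiv; rewrite /eta; lra.
Qed.

End AbsoluteContinuity.

(** * The energy of a positive form *)

Section Energy.
Context (R : realType) (E : rieszSpaceType R) (X : completeNormedModType R).
Context (T : {linear E -> X}) (P : set E).
Hypothesis Pge0 : forall x, P x -> 0 <= x.
Hypothesis P_0 : P 0.
Hypothesis P_down : forall x y, 0 <= y -> y <= x -> P x -> P y.
Hypothesis P_join : forall x y, P x -> P y -> P (riesz_join x y).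
Hypothesis P_mid : midpoint_convex P.
Hypothesis P_cvg : converges_on T P.
Hypothesis T_order_bounded : forall x, 0 <= x ->
  exists M : R, forall y, 0 <= y -> y <= x -> `|T y| <= M.

Implicit Types g h phi : E -> R.

(** The value [g] would take at the top of [P]; for a measure, the total mass. *)
Definition top_value g := sup [set g x | x in P].

Lemma top_value_ub g x : bounded_form P g -> P x -> g x <= top_value g.
Proof.
by move=> [_ [M gM]] Px; apply: ub_le_sup; [exists M => _ [y /gM + <-]|exists x].
Qed.

Lemma top_value_ge0 g : bounded_form P g -> 0 <= top_value g.
Proof. by move=> bg; rewrite -(linear_form0 bg.1.1); exact: top_value_ub. Qed.

(** [P] is directed upward: one join serves near-maximisers of both forms. *)
Lemma top_valueD g h : bounded_form P g -> bounded_form P h ->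
  top_value g + top_value h <= top_value (fun x => g x + h x).
Proof.
move=> bg bh; have ne k : [set k x | x in P] !=set0 by exists (k 0), 0.
rewrite -lerBrDr; apply: ge_sup => // _ [x Px <-].
rewrite lerBrDr addrC -lerBrDr; apply: ge_sup => // _ [y Py <-].
rewrite lerBrDr; have Pxy := P_join Px Py.
have [[pg [M gM]] [ph [N hN]]] := (bg, bh).
apply: (@le_trans _ _ (g (riesz_join x y) + h (riesz_join x y))).
  rewrite addrC lerD//; apply: positive_form_le => //.
    exact: rle_joinl.
  exact: rle_joinr.
apply: top_value_ub => //; split; first exact: positive_formD.
by exists (M + N) => z Pz; rewrite lerD ?gM ?hN.
Qed.

(** Stands for -u <= x <= u when [P] consists of the positive elements below u. *)
Definition parts_in x := P (rpos x) /\ P (rpos (- x)).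

Lemma parts_in_le g x : bounded_form P g -> parts_in x -> `|g x| <= top_value g.
Proof.
move=> bg [Px PNx]; have [lg g0] := bg.1.
have := top_value_ub bg Px; have := top_value_ub bg PNx.
have := g0 _ (rpos_ge0 x); have := g0 _ (rpos_ge0 (- x)).
rewrite -{5}[x]rpos_posN (linear_formB _ _ lg) ler_norml; lra.
Qed.

Lemma parts_in_mid : midpoint_convex parts_in.
Proof.
move=> x y [Px PNx] [Py PNy]; have h0 : 0 <= 2^-1 :> R by rewrite invr_ge0.
by split; [apply: P_down (P_mid Px Py)|apply: P_down (P_mid PNx PNy)];
  rewrite ?rpos_ge0 -?scalerN ?opprD// rposZ// rleZ// rposD.
Qed.

Lemma amgm_div (s a u : R) : 0 <= u -> (u = 0 -> a = 0) ->
  2 * s * a <= a ^+ 2 / u + s ^+ 2 * u.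
Proof.
rewrite le_eqVlt => /predU1P[<-/(_ erefl) ->|u0 _].
  by rewrite !mulr0 expr2 !mul0r addr0.
rewrite -subr_ge0 (_ : _ - _ = (a - s * u) ^+ 2 / u); last by field; rewrite gt_eqF.
by rewrite mulr_ge0 ?sqr_ge0// invr_ge0 ltW.
Qed.

(** Convexity of (a, u) |-> a^2 / u; the chosen [s] maximises 2 s (a + b) - s^2 w. The bounds make
    numerators vanish with their denominators, where the quotient is 0. *)
Lemma sqr_div_split (a b u v w : R) : `|a| <= u -> `|b| <= v -> u + v <= w ->
  (a + b) ^+ 2 / w <= a ^+ 2 / u + b ^+ 2 / v.
Proof.
move=> au bv uvw; have u0 := le_trans (normr_ge0 _) au.
have v0 := le_trans (normr_ge0 _) bv.
have : 0 <= w by lra.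
rewrite le_eqVlt => /predU1P[w0|w0].
  rewrite -w0 invr0 mulr0 addr_ge0// mulr_ge0 ?sqr_ge0 ?invr_ge0//.
set s := (a + b) / w.
have eq0 (c d : R) : `|c| <= d -> d = 0 -> c = 0.
  by move=> cd d0; apply/eqP; rewrite -normr_le0 -d0.
have := amgm_div s u0 (eq0 _ _ au); have := amgm_div s v0 (eq0 _ _ bv).
have : s ^+ 2 * (u + v) <= s ^+ 2 * w by rewrite ler_wpM2l ?sqr_ge0.
have -> : s ^+ 2 * w = (a + b) ^+ 2 / w by rewrite /s; field; rewrite gt_eqF.
have : s * (a + b) = (a + b) ^+ 2 / w by rewrite /s; field; rewrite gt_eqF.
by rewrite mulrDr; lra.
Qed.

Definition form_partition phi (I : finType) (Phi : I -> E -> R) :=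
  (forall i, positive_form (Phi i)) /\ forall x, \sum_i Phi i x = phi x.

Lemma form_partition_bounded phi (I : finType) (Phi : I -> E -> R) i :
  bounded_form P phi -> form_partition phi Phi -> bounded_form P (Phi i).
Proof.
move=> [_ [M phiM]] [pPhi sPhi]; split=> //; exists M => x Px.
apply: le_trans (phiM x Px); rewrite -sPhi (bigD1 i)//= lerDl sumr_ge0// => j _.
by apply: (pPhi j).2; exact: Pge0.
Qed.

Lemma form_partition_top phi (I : finType) (Phi : I -> E -> R) :
  bounded_form P phi -> form_partition phi Phi ->
  \sum_i top_value (Phi i) <= top_value phi.
Proof.
move=> bphi pPhi; rewrite (_ : phi = fun x => \sum_i Phi i x); last first.
  by apply/funext => x; rewrite pPhi.2.
suff [] : bounded_form P (fun x => \sum_i Phi i x) /\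
  \sum_i top_value (Phi i) <= top_value (fun x => \sum_i Phi i x) by [].
elim: (index_enum I) => [|i r [IHb IHs]].
  have b0 : bounded_form P (fun=> 0) by split; [exact: positive_form0|exists 0].
  have -> : (fun x => \sum_(i <- [::]) Phi i x) = fun=> 0.
    by apply/funext => x; rewrite big_nil.
  by split=> //; rewrite big_nil top_value_ge0.
have bi := form_partition_bounded i bphi pPhi.
have -> : (fun x => \sum_(j <- i :: r) Phi j x) =
    fun x => Phi i x + \sum_(j <- r) Phi j x.
  by apply/funext => x; rewrite big_cons.
split; last first.
  by rewrite big_cons; apply: le_trans (top_valueD bi IHb); rewrite lerD2l.
case: bi IHb => [pi [M iM]] [pr [N rN]]; split; first exact: positive_formD.
by exists (M + N) => x Px; rewrite lerD ?iM ?rN.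
Qed.

(* The energy of a partition of phi is the analogue of the squared L2-norm of
   the conditional expectation of x with respect to that partition. *)
Definition energy (I : finType) (Phi : I -> E -> R) x :=
  \sum_i Phi i x ^+ 2 / top_value (Phi i).

Lemma energy_le phi (I : finType) (Phi : I -> E -> R) x :
  bounded_form P phi -> form_partition phi Phi -> parts_in x ->
  0 <= energy Phi x <= top_value phi.
Proof.
move=> bphi pPhi Dx.
have t0 i := top_value_ge0 (form_partition_bounded i bphi pPhi).
apply/andP; split.
  by apply: sumr_ge0 => i _; rewrite mulr_ge0 ?sqr_ge0 ?invr_ge0.
apply: le_trans (form_partition_top bphi pPhi); apply: ler_sum => i _.
have := parts_in_le (form_partition_bounded i bphi pPhi) Dx.
have := t0 i; rewrite le_eqVlt => /predU1P[<-|ti0 le_t].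
  by rewrite invr0 mulr0.
by rewrite ler_pdivrMr// -expr2 -[leLHS]real_normK ?num_real// lerXn2r ?nnegrE// ltW.
Qed.

Lemma energy_parallelogram (I : finType) (Phi : I -> E -> R) x y :
  (forall i, positive_form (Phi i)) ->
  energy Phi (2^-1 *: (x + y)) + energy Phi (x - y) / 4 =
  (energy Phi x + energy Phi y) / 2.
Proof.
move=> pPhi; rewrite /energy !mulrDl !mulr_suml -!big_split; apply: eq_bigr => i _.
have [li _] := pPhi i.
rewrite /= (linear_formZ _ _ li) (linear_formD _ _ li) (linear_formB _ _ li).
set c := (top_value _)^-1; lra.
Qed.

Lemma sum_pair_bool (I : finType) (F : I * bool -> R) :
  \sum_j F j = \sum_i (F (i, true) + F (i, false)).
Proof.
rewrite (eq_bigr (fun j => F (j.1, j.2))); last by case.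
rewrite -(pair_bigA _ (fun i b => F (i, b))) /=.
by apply: eq_bigr => i _; rewrite big_bool.
Qed.

(** A partition sees [x] through averages in which its two parts may cancel. Splitting each form
    along the sign of [x] removes the cancellation, and Cauchy-Schwarz, written with a parameter [s]
    instead of a square root, bounds phi(|x|). The factor 1/2 in the hypothesis suits differences of
    two points. *)
Lemma energy_refine phi (I : finType) (Phi : I -> E -> R) x :
  bounded_form P phi -> form_partition phi Phi -> parts_in (2^-1 *: x) ->
  exists (J : finType) (Psi : J -> E -> R), [/\ form_partition phi Psi,
    forall y, parts_in y -> energy Phi y <= energy Psi y &
    forall s : R, 2 * s * (phi (rpos x) + phi (rpos (- x))) <=
        energy Psi x + s ^+ 2 * top_value phi].
Proof.
move=> bphi pPhi Dx; have [posPhi sumPhi] := pPhi.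
have /choice[g gP] i : exists g, [/\ positive_form g,
    positive_form (fun y => Phi i y - g y) & g x = Phi i (rpos x)].
  exact: positive_form_split.
pose Psi (j : I * bool) y := if j.2 then g j.1 y else Phi j.1 y - g j.1 y.
have pPsi : form_partition phi Psi.
  split=> [[i []]|y]; [by case: (gP i)|by case: (gP i)|].
  rewrite -sumPhi sum_pair_bool.
  by apply: eq_bigr => i _; rewrite /Psi/= addrC subrK.
have bPsi j := form_partition_bounded j bphi pPsi.
exists (I * bool)%type, Psi; split=> // [y Dy|s].
  rewrite /energy sum_pair_bool; apply: ler_sum => i _.
  have {1}-> : Phi i y = Psi (i, true) y + Psi (i, false) y.
    by rewrite /Psi/= addrC subrK.
  apply: sqr_div_split; [exact: parts_in_le|exact: parts_in_le|].
  apply: le_trans (top_valueD (bPsi _) (bPsi _)) _.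
  rewrite (_ : (fun _ => _) = Phi i)//; apply/funext => z.
  by rewrite /Psi/= addrC subrK.
have t0 j := top_value_ge0 (bPsi j).
apply: (@le_trans _ _
  (energy Psi x + s ^+ 2 * \sum_j top_value (Psi j))); last first.
  by rewrite lerD2l ler_wpM2l ?sqr_ge0//; exact: form_partition_top.
rewrite /energy -!sumPhi -big_split !mulr_sumr -big_split /=.
rewrite sum_pair_bool; apply: ler_sum => i _.
have eq0 j : top_value (Psi j) = 0 -> Psi j x = 0.
  move=> tj; have := parts_in_le (bPsi j) Dx.
  rewrite (linear_formZ _ _ (bPsi j).1.1) tj normr_le0 mulf_eq0 invr_eq0.
  by rewrite pnatr_eq0/= => /eqP.
have := amgm_div s (t0 (i, true)) (eq0 _).
have := amgm_div (- s) (t0 (i, false)) (eq0 _).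
have -> : Psi (i, true) x = Phi i (rpos x) by case: (gP i).
have -> : Psi (i, false) x = - Phi i (rpos (- x)).
  rewrite /Psi/=; case: (gP i) => _ _ ->.
  by rewrite -{1}[x]rpos_posN (linear_formB _ _ (posPhi i).1); ring.
rewrite !sqrrN; lra.
Qed.

Lemma scale_half_addrr (V : lmodType R) (a : V) : 2^-1 *: (a + a) = a.
Proof.
by rewrite scalerDr -scalerDl (_ : 2^-1 + 2^-1 = 1 :> R) ?scale1r//; lra.
Qed.

Lemma parts_in_norm (M : R) x : (forall y, P y -> `|T y| <= M) ->
  parts_in x -> `|T x| <= M + M.
Proof.
move=> TM [Px PNx]; rewrite -[x]rpos_posN linearB.
by apply: (le_trans (ler_normB _ _)); apply: lerD; exact: TM.
Qed.

(** An order interval with end points in the bidual has to be centred at a point of E, whence the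
    translation. *)
Lemma image_translate_weakly_compact (a : E) :
  relatively_weakly_compact (T @` [set x | parts_in (x - a)]).
Proof.
have [M TM] := converges_on_bounded Pge0 P_0 P_mid P_cvg.
have T_bounded : exists M : R, forall x, P x -> `|T x| <= M by exists M.
have midB x y : 2^-1 *: (x + y) - a = 2^-1 *: ((x - a) + (y - a)).
  by rewrite -{1}[a]scale_half_addrr -scalerBr opprD addrACA.
apply: image_weakly_compact => [x y /= Dx Dy||e e0].
- by rewrite midB; exact: parts_in_mid.
- exists (M + M + `|T a|) => x /= Dx; rewrite -[x](subrK a) linearD.
  apply: (le_trans (ler_normD _ _)); rewrite lerD2r.
  exact: parts_in_norm TM Dx.
have e40 : 0 < e / 4 by rewrite divr_gt0.
have [phi bphi phie] :=
  dominating_form Pge0 P_down P_join P_cvg T_order_bounded T_bounded e40.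
pose A x := [set q | exists (I : finType) (Phi : I -> E -> R),
  form_partition phi Phi /\ q = energy Phi x].
have Ane x : A x !=set0.
  exists (energy (fun _ : unit => phi) x), unit, (fun=> phi); split=> //.
  by split=> [_|y]; [exact: bphi.1|rewrite (bigD1 tt)//= big1 ?addr0// => -[]].
have Aub x : parts_in x -> ubound (A x) (top_value phi).
  by move=> Dx _ [I [Phi [pPhi ->]]]; case/andP: (energy_le bphi pPhi Dx).
have Asup x (I : finType) (Phi : I -> E -> R) : parts_in x ->
    form_partition phi Phi -> energy Phi x <= sup (A x).
  move=> Dx pPhi; apply: ub_le_sup; last by exists I, Phi.
  by exists (top_value phi); exact: Aub.
pose W := top_value phi; have W0 : 0 <= W := top_value_ge0 bphi.
(* A defect of s / 4, plus s / 4 for a near-optimal partition at the midpoint, leaves the difference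
   an energy of at most 2 s; as s W <= 1, parameter [s] in Cauchy-Schwarz gives phi(|x' - y'|) <= 3
   / 2. *)
pose s := (W + 1)^-1; have s0 : 0 < s by rewrite invr_gt0; lra.
have sW : s * W <= 1 by rewrite /s ler_pdivrMl; lra.
exists (fun x => sup (A (x - a))), W, (s / 4); split=> [|x /= Dx|x y /= Dx Dy].
- by rewrite divr_gt0.
- rewrite ger0_norm; first by apply: ge_sup => //; exact: Aub.
  have [q Aq] := Ane (x - a); have [I [Phi [pPhi qE]]] := Aq.
  apply: le_trans (Asup _ _ _ Dx pPhi).
  by case/andP: (energy_le bphi pPhi Dx).
rewrite midB; set x' := x - a in Dx *; set y' := y - a in Dy *.
set m := 2^-1 *: (x' + y') => Qm.
have Dm : parts_in m by exact: parts_in_mid.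
have -> : T x - T y = T (x' - y') by rewrite -linearB /x' /y' opprB addrA subrK.
have Dd : parts_in (2^-1 *: (x' - y')).
  by apply: parts_in_mid => //; split; [exact: Dy.2|rewrite opprK; exact: Dy.1].
have s40 : 0 < s / 4 by rewrite divr_gt0.
have [_ [I [Phi [pPhi ->]]] Phim] := sup_adherent s40
  (conj (Ane m) (ex_intro _ _ (Aub _ Dm))).
have [J [Psi [pPsi lePsi Psis]]] := energy_refine bphi pPhi Dd.
have small : phi (rpos (x' - y')) + phi (rpos (- (x' - y'))) <= 2.
  have := energy_parallelogram x' y' pPsi.1; rewrite -/m.
  have := lePsi _ Dm; have := Asup _ _ _ Dx pPsi; have := Asup _ _ _ Dy pPsi.
  have := Psis s; rewrite -/W.
  have : s ^+ 2 * W <= s by rewrite expr2 -mulrA ler_piMr// ltW.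
  set t := _ + phi _ => h1 h2 h3 h4 h5 h6.
  rewrite -(ler_pM2l s0); lra.
(* The parts of the difference lie in 2 P, so domination applies to their halves; hence the choice
   of [e / 4]. *)
have half_small z : 0 <= z -> P (2^-1 *: z) -> phi z <= 2 -> `|T z| <= e / 2.
  move=> z0 Pz phiz; have phi1 : phi (2^-1 *: z) <= 1.
    by rewrite (linear_formZ _ _ bphi.1.1); lra.
  by have := phie _ Pz phi1; rewrite linearZ normrZ gtr0_norm ?invr_gt0//; lra.
have [p0 q0] := (rpos_ge0 (x' - y'), rpos_ge0 (- (x' - y'))).
have [pphi0 qphi0] := (bphi.1.2 _ p0, bphi.1.2 _ q0).
have h0 : 0 <= 2^-1 :> R by rewrite invr_ge0.
rewrite -[x' - y']rpos_posN linearB [e]splitr.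
apply: (le_trans (ler_normB _ _)); apply: lerD; apply: half_small => //.
- by rewrite -rposZ//; exact: Dd.1.
- lra.
- by rewrite -rposZ// scalerN; exact: Dd.2.
- lra.
Qed.

End Energy.

(** * Solid neighborhoods and the strong dual *)

Section SolidNeighborhoods.
Context (R : realType) (E : lcSolidRieszType R).
Implicit Types (x y z : E) (V B : set E).

Lemma convex_setP V (l : R) x y : convex_set V -> 0 <= l -> l <= 1 ->
  V x -> V y -> V (l *: x + (1 - l) *: y).
Proof.
move=> cV l0 l1 /mem_set Vx /mem_set Vy; apply/set_mem.
exact: (cV x y (Itv01 l0 l1)).
Qed.

Lemma solid_ge0 V x y : solid V -> 0 <= x -> x <= y -> V y -> V x.
Proof.
move=> sV x0 xy Vy; apply: sV Vy _; rewrite !rabs_id//.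
exact: le_trans xy.
Qed.

Lemma solid_pos V x : solid V -> V x -> V (rpos x).
Proof.
move=> sV Vx; apply: sV Vx _; rewrite rabs_id ?rpos_ge0//.
by apply: rpos_le (rabs_ge0 _); exact: rle_joinl.
Qed.

Lemma solidN V x : solid V -> V x -> V (- x).
Proof.
move=> sV Vx; apply: sV Vx _.
by apply: rjoin_le; rewrite ?opprK ?rle_joinl ?rle_joinr.
Qed.

Lemma convex_solid_scale V x (a b : R) : convex_set V -> solid V ->
  0 < a -> a <= b -> V (a^-1 *: x) -> V (b^-1 *: x).
Proof.
move=> cV sV a0 ab Vx; have b0 := lt_le_trans a0 ab.
have V0 : V 0 by apply: sV Vx _; rewrite rabs_id// rabs_ge0.
have := convex_setP (l := a / b) cV _ _ Vx V0.
rewrite scaler0 addr0 scalerA mulrAC divff ?gt_eqF// mul1r; apply.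
  by rewrite divr_ge0 ?ltW.
by rewrite ler_pdivrMr// mul1r.
Qed.

Lemma topologically_boundedP B : topologically_bounded B <->
  forall V, nbhs 0 V -> convex_set V -> solid V ->
    exists2 r : R, 0 < r & forall x, B x -> V (r^-1 *: x).
Proof.
split=> [bB V V0 cV sV|bB U /lcsolid_base[V [V0 cV sV VU]]].
  have [r r0 BV] := bB V V0; exists r => // x /BV[u Vu <-].
  by rewrite scalerA mulVf ?gt_eqF// scale1r.
have [r r0 BV] := bB V V0 cV sV; exists r => // x /BV Vx.
exists (r^-1 *: x); first exact: VU.
by rewrite scalerA divff ?gt_eqF// scale1r.
Qed.

Lemma topologically_bounded_sub B B' : B' `<=` B ->
  topologically_bounded B -> topologically_bounded B'.
Proof.
by move=> B'B bB U U0; have [r r0 BU] := bB U U0; exists r => // x /B'B; exact: BU.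
Qed.

Lemma topologically_boundedU B B' :
  topologically_bounded B -> topologically_bounded B' ->
  topologically_bounded (B `|` B').
Proof.
move=> /topologically_boundedP bB /topologically_boundedP bB'.
apply/topologically_boundedP => V V0 cV sV.
have [r r0 rV] := bB V V0 cV sV; have [s s0 sV'] := bB' V V0 cV sV.
exists (Num.max r s) => [|x]; first by rewrite lt_max r0.
case=> [/rV|/sV']; apply: convex_solid_scale => //; by rewrite le_max lexx ?orbT.
Qed.

Lemma order_interval_bounded x :
  topologically_bounded [set y | 0 <= y /\ y <= x].
Proof.
apply/topologically_boundedP => V V0 cV sV.
have /topologically_boundedP/(_ V V0 cV sV)[r r0 rV] :=
  @topologically_bounded1 R E x.
exists r => // y [y0 yx].
have r1 : 0 <= r^-1 by rewrite invr_ge0 ltW.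
by apply: solid_ge0 (rV x erefl) => //; [exact: riesz_scaler_ge0|exact: rleZ].
Qed.

Lemma form_continuous (f : E -> R) V : linear_form f -> nbhs 0 V ->
  (forall x, V x -> `|f x| <= 1) -> f \in @continuous_linear R E.
Proof.
move=> lf V0 fV; apply/asboolP; split=> // x.
apply/(@cvgrPdist_le _ R^o) => e e0.
have : nbhs x (+%R x @` ( *:%R e @` V)).
  by apply: nbhsT; apply: nbhs0Z => //; rewrite gt_eqF.
apply: filterS => _ [_ [v Vv <-] <-].
rewrite (linear_formD _ _ lf) (linear_formZ _ _ lf) opprD addrA subrr sub0r.
by rewrite normrN normrM gtr0_norm// -[leRHS]mulr1 ler_pM2l// fV.
Qed.

Lemma dual_linear_form (f : dual E) : linear_form f.
Proof. by move=> a x y; rewrite linearP. Qed.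

Lemma dual_nbhs0 (f : dual E) : nbhs 0 [set x | `|f x| <= 1].
Proof.
have f0 : f 0 = 0 by rewrite linear0.
have := @dual_continuous R E f 0 => /cvgrPdist_le/(_ 1 ltr01).
by apply: filterS => x /=; rewrite f0 sub0r normrN.
Qed.

(** The dual is an order ideal: g(x) <= g(x^+) <= f(x^+), and a solid neighborhood contains x^+ and
    -x along with x. *)
Lemma dominated_form_continuous (f : dual E) (g : E -> R) :
  positive_form g -> positive_form (fun x => f x - g x) ->
  g \in @continuous_linear R E.
Proof.
move=> pg pfg; have /lcsolid_base[V [V0 cV sV VU]] := dual_nbhs0 f.
have gV x : V x -> g x <= 1.
  move=> Vx; apply: le_trans (positive_form_le pg (rle_pos x)) _.
  have := pfg.2 _ (rpos_ge0 x); rewrite subr_ge0 => /le_trans; apply.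
  by apply: le_trans (ler_norm _) _; apply: VU; exact: solid_pos.
apply: form_continuous pg.1 V0 _ => x Vx; rewrite ler_norml gV// andbT.
by rewrite lerNl -(linear_formN _ pg.1) gV//; exact: solidN.
Qed.

Lemma strong_dual_nbhs0 (U : set (dual E)) : nbhs 0 U ->
  exists B (e : R), [/\ topologically_bounded B, 0 < e &
    [set f : dual E | forall b, B b -> `|f b| <= e] `<=` U].
Proof.
pose G : set_system (dual E) := filter_from
  [set p : set E * R | topologically_bounded p.1 /\ 0 < p.2]
  (fun p => [set f : dual E | forall b, p.1 b -> `|f b| <= p.2]).
have FG : Filter G.
  apply: filter_from_filter.
    exists ([set 0], 1); split => //; exact: topologically_bounded1.
  move=> [B e] [B' e'] [/= bB e0] [/= bB' e'0].
  exists (B `|` B', Num.min e e').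
    by split=> /=; [exact: topologically_boundedU|rewrite lt_min e0].
  move=> f /= fB; split=> b Bb.
    by have := fB b (or_introl Bb); rewrite le_min => /andP[].
  by have := fB b (or_intror Bb); rewrite le_min => /andP[].
have G0 : G --> (0 : dual E).
  apply: (@cvg_initial (dual E) {family @topologically_bounded R E, E -> R^o}
    (@dual_fun R E) G 0 FG).
  apply/fam_cvgP => B bB A /uniform_nbhs[W [entW WA]].
  move: entW; rewrite -entourage_from_ballE => -[e /= e0 eW].
  have e20 : 0 < e / 2 by rewrite divr_gt0.
  exists (B, e / 2) => // f /= fB; apply: WA => b Bb; apply: eW.
  rewrite /= -ball_normE/= sub0r normrN (le_lt_trans (fB b Bb))//.
  by rewrite ltr_pdivrMr// ltr_pMr// ltr1n.
by move=> /G0[[B e] [/= bB e0] BU]; exists B, e.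
Qed.

End SolidNeighborhoods.

(** * Order intervals of the bidual *)

Section BidualInterval.
Context (R : realType) (E : lcSolidRieszType R).
Implicit Types (x y z : E) (u : dual (dual E)).

Definition positive_dual (f : dual E) := forall x, 0 <= x -> 0 <= f x.

(** The trace on E of the order interval [0, u] of E''; it becomes the set [P] above. *)
Definition below_bidual u := [set x : E | 0 <= x /\
  forall f : dual E, positive_dual f -> f x <= u f].

Lemma bidual_leP (phi psi : dual (dual E)) :
  bidual_le phi psi <-> forall f : dual E, positive_dual f -> phi f <= psi f.
Proof.
split=> [le f pf|le f pf].
  by rewrite -subr_ge0; exact: le.
by have := le f pf; rewrite -subr_ge0.
Qed.

Lemma below_bidual_down u x y :
  0 <= y -> y <= x -> below_bidual u x -> below_bidual u y.
Proof.
move=> y0 yx [x0 xu]; split=> // f pf; apply: le_trans (xu f pf).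
by apply: positive_form_le => //; split=> //; exact: dual_linear_form.
Qed.

Lemma below_bidual_mid u : midpoint_convex (below_bidual u).
Proof.
have h0 : 0 <= 2^-1 :> R by rewrite invr_ge0.
move=> x y [x0 xu] [y0 yu]; split.
  by apply: riesz_scaler_ge0 => //; exact: raddr_ge0.
move=> f pf; have lf := dual_linear_form f.
have := xu f pf; have := yu f pf.
by rewrite (linear_formZ _ _ lf) (linear_formD _ _ lf); lra.
Qed.

(** f(x^+) = g(x) for some g in the dual with 0 <= g <= f, and g(x) <= u(g) <= u(f). *)
Lemma below_bidual_pos u x : (forall f, positive_dual f -> 0 <= u f) ->
  (forall f, positive_dual f -> f x <= u f) -> below_bidual u (rpos x).
Proof.
move=> u0 xu; split=> [|f pf]; first exact: rpos_ge0.
have posf : positive_form f by split=> //; exact: dual_linear_form.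
have [g [pg pfg <-]] := positive_form_split x posf.
pose G : dual E := Dual (dominated_form_continuous pg pfg).
have := xu G pg.2; have := u0 (f - G) pfg.2.
have -> : u (f - G) = u f - u G by rewrite linearB.
by rewrite subr_ge0 => le1 le2; exact: le_trans le1.
Qed.

(** If 0 <= g <= f and g(y - x) = f((y - x)^+), then f(x \/ y) = (f - g)(x) + g(y) <= u(f - g) +
    u(g). *)
Lemma below_bidual_join u x y :
  below_bidual u x -> below_bidual u y -> below_bidual u (riesz_join x y).
Proof.
move=> [x0 xu] [y0 yu]; split; first exact: le_trans (rle_joinl _ _).
move=> f pf; have posf : positive_form f by split=> //; exact: dual_linear_form.
have [g [pg pfg gyx]] := positive_form_split (y - x) posf.
pose G : dual E := Dual (dominated_form_continuous pg pfg).
rewrite rjoinE (linear_formD _ _ posf.1) -gyx (linear_formB _ _ pg.1).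
have := yu G pg.2; have := xu (f - G) pfg.2.
have -> : u (f - G) = u f - u G by rewrite linearB.
have -> : (f - G) x = f x - g x by [].
have -> : G y = g y by [].
lra.
Qed.

Lemma bidual_bound u : exists B (c : R), [/\ topologically_bounded B, 0 < c &
  forall (f : dual E) (s : R), 0 < s -> (forall b, B b -> `|f b| <= s) ->
    u f <= s * c].
Proof.
have : nbhs (0 : dual E) [set f | `|u f| <= 1].
  have := @dual_continuous R (dual E) u 0 => /cvgrPdist_le/(_ 1 ltr01).
  have -> : u 0 = 0 by rewrite linear0.
  by apply: filterS => x /=; rewrite sub0r normrN.
move=> /strong_dual_nbhs0[B [e [bB e0 BU]]].
exists B, e^-1; split=> //; first by rewrite invr_gt0.
move=> f s s0 fB; have es0 : 0 < e / s by rewrite divr_gt0.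
have /BU/= : [set f : dual E | forall b, B b -> `|f b| <= e] ((e / s) *: f).
  move=> b /fB fb; have -> : ((e / s) *: f) b = e / s * f b by [].
  by rewrite normrM gtr0_norm// -mulrA ler_piMr ?(ltW e0)// ler_pdivrMl// mulr1.
have -> : u ((e / s) *: f) = e / s * u f by rewrite linearZ.
move=> /(le_trans (ler_norm _)); rewrite -ler_pdivlMl//.
by rewrite mulr1 invf_div.
Qed.

(** The gauge of [V] at y^+ is sublinear in y. A linear form below it that touches it at [x] is
    positive, continuous and at most [s] on [B], so x <= u bounds the gauge of [x] by [s * c]. *)
Lemma below_bidual_bounded u : topologically_bounded (below_bidual u).
Proof.
apply/topologically_boundedP => V V0 cV sV.
have [B [c [/topologically_boundedP bB c0 uB]]] := bidual_bound u.
have [s s0 sB] := bB V V0 cV sV.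
(* The extra 1 allows for a gauge that is not attained. *)
exists (s * c + 1) => [|x [x0 xu]]; first by rewrite addr_gt0// mulr_gt0.
pose A y := [set t : R | 0 < t /\ V (t^-1 *: rpos y)].
have Alb y : has_lbound (A y) by exists 0 => t [/ltW].
have Ane y : A y !=set0.
  have /topologically_boundedP/(_ V V0 cV sV)[r r0 rV] :=
    @topologically_bounded1 R E (rpos y).
  by exists r; split=> //; exact: rV.
have VE y : V 0 by apply: sV (nbhs_singleton V0) _.
have infA y t : A y t -> inf (A y) <= t by move=> At; exact: ge_inf.
have A0 y t : rpos y = 0 -> 0 < t -> A y t.
  by move=> y0 t0; split=> //; rewrite y0 scaler0; exact: (VE 0).
have inf0 y : rpos y = 0 -> inf (A y) <= 0.
  by move=> y0; apply/ler_addgt0Pl => e e0; rewrite addr0; exact/infA/A0.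
have sub : sublinear (fun y => inf (A y)).
  split=> [a y|y z].
    rewrite le_eqVlt => /predU1P[<-|a0].
      by rewrite scale0r mul0r; apply: inf0; rewrite rpos_id.
    rewrite -ler_pdivrMl//; apply: lb_le_inf => // t [t0 Vt].
    rewrite ler_pdivrMl//; apply: infA; split; first exact: mulr_gt0.
    by rewrite rposZ ?(ltW a0)// scalerA invfM mulrAC mulVf ?gt_eqF// mul1r.
  rewrite -lerBlDr; apply: lb_le_inf => // t [t0 Vt].
  rewrite lerBlDr -lerBlDl; apply: lb_le_inf => // r [r0 Vr].
  rewrite lerBlDl; apply: infA; have tr0 : 0 < t + r by exact: addr_gt0.
  split=> //; have tri : 0 <= (t + r)^-1 by rewrite invr_ge0 ltW.
  have := convex_setP (l := t / (t + r)) cV _ _ Vt Vr.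
  rewrite !scalerA (_ : _ * t^-1 = (t + r)^-1); last by field; rewrite !gt_eqF.
  rewrite (_ : _ * r^-1 = (t + r)^-1); last by field; rewrite !gt_eqF.
  rewrite -scalerDr => /(_ _ _)/(solid_ge0 sV _ _); apply.
  - by apply: riesz_scaler_ge0 => //; exact: rpos_ge0.
  - by apply: rleZ => //; exact: rposD.
  - by rewrite divr_ge0// ltW.
  - by rewrite ler_pdivrMr// mul1r lerDl ltW.
have [f [lf fp fx]] := hahn_banach x sub.
have fV (e : R) v : 0 < e -> V (e^-1 *: v) -> `|f v| <= e.
  move=> e0 Vv; have ei : 0 <= e^-1 by rewrite invr_ge0 ltW.
  rewrite ler_norml lerNl -(linear_formN _ lf); apply/andP; split.
    apply: (le_trans (fp _)); apply: infA; split=> //.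
    by rewrite -rposZ// scalerN; apply: solid_pos => //; exact: solidN.
  apply: (le_trans (fp _)); apply: infA; split=> //.
  by rewrite -rposZ//; exact: solid_pos.
have cf : f \in @continuous_linear R E.
  by apply: (form_continuous lf V0) => v Vv; apply: fV; rewrite // invr1 scale1r.
have pf : positive_dual (Dual cf).
  move=> y y0; change (0 <= f y); rewrite -oppr_le0 -(linear_formN _ lf).
  by apply: (le_trans (fp _)); apply: inf0; rewrite rpos_eq0// -oppr0 rleN2.
have : inf (A x) <= s * c.
  rewrite -fx; apply: le_trans (xu _ pf) _.
  by apply: uB => // b /sB; exact: fV.
have [t [t0 Vt] tx] := inf_adherent ltr01 (conj (Ane x) (Alb x)).
move=> xsc; move: Vt; rewrite rpos_id//; apply: convex_solid_scale => //.
by rewrite ltW// (lt_le_trans tx)// lerD2r.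
Qed.

End BidualInterval.

Section Sufficiency.
Context (R : realType) (E : lcSolidRieszType R) (X : completeNormedModType R).
Context (T : {linear E -> X}).

Lemma monotone_convergence_gbwc :
  (forall x_ : nat -> E,
    (forall n, 0 <= x_ n) ->
    (forall m n, (m <= n)%N -> x_ m <= x_ n) ->
    topologically_bounded (range x_) ->
    cvg (T (x_ n) @[n --> \oo])) -> generalized_b_weakly_compact T.
Proof.
move=> Tcvg A [phi [psi phipsi]].
(* A point of [A] serves as the centre and shows that phi <= psi. *)
have [->|/set0P[a Aa]] := eqVneq A set0.
  rewrite image_set0 /relatively_weakly_compact closure0; exact: compact0.
have bounded_cvg B : topologically_bounded B -> (forall x, B x -> 0 <= x) ->
    converges_on T B.
  move=> bB B0 x_ xB x1; apply: Tcvg => [n||]; first exact: B0.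
    exact: rincreasing.
  by apply: topologically_bounded_sub bB => _ [n _ <-].
have T_order_bounded (x : E) : 0 <= x ->
    exists M : R, forall y, 0 <= y -> y <= x -> `|T y| <= M.
  move=> x0; have [||y z [y0 yx] [z0 zx]||M TM] :=
      @converges_on_bounded _ _ _ T [set y | 0 <= y /\ y <= x].
  - by move=> y [].
  - by split.
  - have h0 : 0 <= 2^-1 :> R by rewrite invr_ge0.
    split; first by apply: riesz_scaler_ge0 => //; exact: raddr_ge0.
    by rewrite -[leRHS](scale_half_addrr x); apply: rleZ => //; exact: rleD.
  - by apply: bounded_cvg; [exact: order_interval_bounded|move=> y []].
  by exists M => y y0 yx; exact: TM.
pose u := psi - phi; pose P := below_bidual u.
have u0 f : positive_dual f -> 0 <= u f.
  move=> pf; have [/bidual_leP le1 /bidual_leP le2] := phipsi a Aa.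
  by have := le_trans (le1 f pf) (le2 f pf); rewrite -subr_ge0.
have P0 : P 0 by split=> // f pf; rewrite linear0 u0.
have diffP (x y : E) : A x -> A y -> P (rpos (x - y)).
  move=> /phipsi[_ /bidual_leP xpsi] /phipsi[/bidual_leP phiy _].
  apply: below_bidual_pos => // f pf; rewrite linearB.
  by have := lerB (xpsi f pf) (phiy f pf).
have := image_translate_weakly_compact (fun x (Px : P x) => Px.1) P0
  (@below_bidual_down _ _ u) (@below_bidual_join _ _ u) (@below_bidual_mid _ _ u)
  (bounded_cvg _ (below_bidual_bounded u) (fun x (Px : P x) => Px.1))
  T_order_bounded (a := a).
move=> cK; apply: subclosed_compact cK _; first exact: closed_closure.
apply: closureS; apply: image_subset => x Ax; split; first exact: diffP.
by rewrite opprB; exact: diffP.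
Qed.

End Sufficiency.

(** * Subseries in weakly compact sets *)

Section DistanceForm.
Context (R : realType) (X : completeNormedModType R).

(** Hahn-Banach for the distance to [Y], which is sublinear and vanishes on [Y]. *)
Lemma subspace_separation (Y : set X) (z : X) (d : R) :
  Y 0 -> (forall u v, Y u -> Y v -> Y (u + v)) ->
  (forall (a : R) u, Y u -> Y (a *: u)) ->
  0 < d -> (forall c, Y c -> d <= `|z - c|) ->
  exists f : X -> R, [/\ contraction_form f, forall c, Y c -> f c = 0 & d <= f z].
Proof.
move=> Y0 YD YZ d0 dz; pose A x := [set `|x - c| | c in Y].
have Alb x : has_lbound (A x) by exists 0 => _ [c _ <-].
have Ane x : A x !=set0 by exists `|x - 0|, 0.
have infA x c : Y c -> inf (A x) <= `|x - c|.
  by move=> Yc; apply: ge_inf => //; exists c.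
have sub : sublinear (fun x => inf (A x)).
  split=> [a y|y w].
    rewrite le_eqVlt => /predU1P[<-|a0].
      by rewrite scale0r mul0r; have := infA 0 _ Y0; rewrite subrr normr0.
    rewrite -ler_pdivrMl//; apply: lb_le_inf => // _ [c Yc <-].
    rewrite ler_pdivrMl// -[X in X * _]gtr0_norm// -normrZ scalerBr.
    exact/infA/YZ.
  rewrite -lerBlDr; apply: lb_le_inf => // _ [c Yc <-].
  rewrite lerBlDr -lerBlDl; apply: lb_le_inf => // _ [c' Yc' <-].
  rewrite lerBlDl; apply: le_trans (infA _ _ (YD _ _ Yc Yc')) _.
  by rewrite opprD addrACA ler_normD.
have [f [lf fp fz]] := hahn_banach z sub.
have f0 c : Y c -> f c <= 0.
  by move=> Yc; apply: le_trans (fp _) _; have := infA c _ Yc; rewrite subrr normr0.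
exists f; split.
- apply: contraction_form_le => // x; apply: le_trans (fp x) _.
  by have := infA x _ Y0; rewrite subr0.
- move=> c Yc; apply/eqP; rewrite eq_le f0//= -oppr_le0 -(linear_formN _ lf).
  by rewrite -scaleN1r f0//; exact: YZ.
- by rewrite fz; apply: lb_le_inf => // _ [c Yc <-]; exact: dz.
Qed.

Lemma rational_combination_dense (y_ : nat -> X) (a_ : nat -> R) n (d : R) :
  0 < d -> exists q : seq rat,
    `|\sum_(i < n) a_ i *: y_ i - \sum_(i < size q) ratr q`_i *: y_ i| <= d.
Proof.
move=> d0; pose w i := d / n.+1%:R / (`|y_ i| + 1).
have w0 i : 0 < w i by rewrite !divr_gt0// ltr_wpDl.
have /choice[q qP] i : exists q : rat, `|a_ i - ratr q| <= w i.
  have [|q] := @rat_in_itvoo R (a_ i - w i) (a_ i + w i).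
    by have := w0 i; lra.
  by rewrite in_itv/= => /andP[h1 h2]; exists q; rewrite ler_norml; lra.
exists (mkseq q n); rewrite size_mkseq -sumrB.
apply: le_trans (ler_norm_sum _ _ _) _.
apply: (@le_trans _ _ (\sum_(i < n) d / n.+1%:R)); last first.
  rewrite sumr_const card_ord -[leLHS]mulr_natr -mulrA ler_piMr ?(ltW d0)//.
  by rewrite mulrC ler_pdivrMr// mul1r ler_nat.
apply: ler_sum => i _; rewrite nth_mkseq// -scalerBl normrZ.
apply: le_trans (ler_wpM2r (normr_ge0 _) (qP i)) _.
rewrite /w mulrAC ler_pdivrMr ?ltr_wpDl// ler_wpM2l ?lerDl//.
by rewrite divr_ge0// ltW.
Qed.

Lemma weak_cluster_eval (s_ : nat -> X) (z : X) (f : X -> R) (d : R) N :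
  @cluster (weak_topology X) (s_ n @[n --> \oo]) z ->
  contraction_form f -> 0 < d ->
  exists2 n, (N <= n)%N & `|f z - f (s_ n)| < d.
Proof.
move=> cz cf d0.
have nz : nbhs (z : weak_topology X) [set w | `|f z - f w| < d].
  have := @weak_eval_continuous R X (contraction_dual cf) z _
    (@nbhsx_ballx _ R^o (f z) _ d0).
  apply: (@filterS _ _ (nbhs_filter (z : weak_topology X))) => w.
  by rewrite -ball_normE.
have [_ [[n Nn <-] /= fn]] := cz [set s_ n | n in [set n | (N <= n)%N]] _
  (ex_intro2 _ _ N I (fun n Nn => ex_intro2 _ _ n Nn erefl)) nz.
by exists n.
Qed.

Lemma real_series_tail (a_ : nat -> R) (M d : R) : 0 < d ->
  (forall n, \sum_(i < n) `|a_ i| <= M) ->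
  exists N, forall n, (N <= n)%N ->
    \sum_(i < n) `|a_ i| - \sum_(i < N) `|a_ i| <= d.
Proof.
move=> d0 aM; pose A := [set \sum_(i < n) `|a_ i| | n in [set: nat]].
have A0 : has_sup A.
  by split; [exists (\sum_(i < 0) `|a_ i|), 0%N|exists M => _ [n _ <-]].
have [_ [N _ <-] NA] := sup_adherent d0 A0.
exists N => n _; have : \sum_(i < n) `|a_ i| <= sup A.
  by apply: ub_le_sup; [case: A0|exists n].
lra.
Qed.

(* A version of the Orlicz-Pettis theorem.  If |y_k| stayed above e, then for
   each point c of the countable set of rational combinations a finite 0/1 word
   could be extended so that every longer word has its sum at a fixed weak
   distance from c; a word built in this way for all c at once has its weak
   cluster point off the closed span of the y_k, which is impossible. *)
Lemma subseries_compact_not_bounded_away (y_ : nat -> X) (K : set X) (e : R) :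
  compact (K : set (weak_topology X)) ->
  (forall (b : nat -> bool) n, K (\sum_(i < n) (b i)%:R *: y_ i)) ->
  (forall f, contraction_form f ->
    exists M : R, forall n, \sum_(i < n) `|f (y_ i)| <= M) ->
  0 < e -> ~ forall i, e < `|y_ i|.
Proof.
move=> cK Ksum fM e0 ye; pose d := e / 4.
have d0 : 0 < d by rewrite divr_gt0.
pose sum (b : nat -> bool) n : X := \sum_(i < n) (b i)%:R *: y_ i.
have sumS b n : sum b n.+1 = sum b n + (b n)%:R *: y_ n by rewrite /sum big_ord_recr.
have sum_eq b b' n : (forall i, (i < n)%N -> b i = b' i) -> sum b n = sum b' n.
  by move=> bb; apply: eq_bigr => i _; rewrite bb.
(* A state is a word with the length up to which it counts; [g] extends it so as to stay away from
   the point [p.2]. *)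
have /choice[g gP] (p : (nat * (nat -> bool)) * X) :
    exists q : nat * (nat -> bool), [/\ (p.1.1 < q.1)%N,
      forall i, (i < p.1.1)%N -> q.2 i = p.1.2 i &
      exists2 f : X -> R, contraction_form f & forall b,
        (forall i, (i < q.1)%N -> b i = q.2 i) -> forall n, (q.1 <= n)%N ->
        d <= f (sum b n - p.2)].
  case: p => [[N b] c] /=.
  (* The two candidate sums differ by [y_ N], of norm above 4 d, so one of them is more than 2 d
     away from [c]. *)
  have [t tP] : exists t : bool, 2 * d < `|sum b N + t%:R *: y_ N - c|.
    apply: contrapT => /forallNP h.
    have := h true; have := h false => /negP + /negP; rewrite -!leNgt.
    rewrite scale0r addr0 scale1r => h0 h1; have := ye N; apply/negP; rewrite -leNgt.
    have -> : y_ N = (sum b N + y_ N - c) - (sum b N - c).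
      by rewrite opprB addrA subrK addrC addKr.
    apply: le_trans (ler_normB _ _) _; rewrite /d in h0 h1; lra.
  have [f cf fE] := norming_form (sum b N + t%:R *: y_ N - c).
  have [M fMn] := fM f cf.
  have [N' /= NP] := @real_series_tail (fun i => f (y_ i)) M d d0 fMn.
  pose N1 := maxn N.+1 N'.
  (* Zeros pad the word up to [N1], past which the |f(y_i)| sum to at most [d]; every continuation
     thus keeps a margin of 2 d - d. *)
  pose b1 i := if (i < N)%N then b i else (i == N) && t.
  exists (N1, b1); split=> [|i iN|]; first by rewrite leq_max ltnSn.
    by rewrite /b1/= iN.
  exists f => // b2 bb n N1n /=; have lf := cf.1.
  have e1 : sum b2 N1 = sum b N + t%:R *: y_ N.
    rewrite -(@sum_eq b1) => [|i /bb//].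
    have N1E : N1 = (N.+1 + (N1 - N.+1))%N by rewrite subnKC// leq_maxl.
    have -> : sum b N + t%:R *: y_ N = sum b1 N.+1.
      rewrite sumS {2}/b1 ltnn eqxx/=; congr (_ + _).
      by apply: sum_eq => i iN; rewrite /b1 iN.
    rewrite N1E; elim: (N1 - N.+1)%N => [|m IH]; first by rewrite addn0.
    rewrite addnS sumS IH /b1 ltnNge (leq_trans (leqnSn N) (leq_addr _ _))/=.
    by rewrite gtn_eqF ?scale0r ?addr0// leq_addr.
  have tail m : (N1 <= m)%N -> `|f (sum b2 m) - f (sum b2 N1)| <=
      \sum_(i < m) `|f (y_ i)| - \sum_(i < N1) `|f (y_ i)|.
    elim: m => [|m IH]; first by rewrite leqn0 => /eqP ->; rewrite !subrr normr0.
    rewrite leq_eqVlt => /predU1P[<-|/IH h]; first by rewrite !subrr normr0.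
    rewrite sumS (linear_formD _ _ lf) (linear_formZ _ _ lf) big_ord_recr/=.
    rewrite addrAC [leRHS]addrAC; apply: le_trans (ler_normD _ _) _.
    rewrite lerD// normrM ler_piMl//; by case: (b2 m); rewrite ?normr1 ?normr0.
  have tail_d : \sum_(i < n) `|f (y_ i)| - \sum_(i < N1) `|f (y_ i)| <= d.
    have N'1 : (N' <= N1)%N by rewrite leq_maxr.
    have := NP n (leq_trans N'1 N1n); apply: le_trans; rewrite lerD2l lerN2.
    rewrite -(subnKC N'1); elim: (N1 - N')%N => [|m IH]; first by rewrite addn0.
    by rewrite addnS big_ord_recr/= (le_trans IH)// lerDl.
  have := le_trans (tail n N1n) tail_d.
  rewrite e1 ler_norml (linear_formB _ _ lf).
  rewrite -fE (linear_formB _ _ lf) in tP; lra.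
pose c_ j : X := let q := odflt [::] (unpickle j) in
  \sum_(i < size q) ratr q`_i *: y_ i.
pose st := fix st j := if j is j'.+1 then g (st j', c_ j') else (0%N, fun=> false).
have stP j := gP (st j, c_ j).
have st_ge j : (j <= (st j).1)%N.
  by elim: j => // j IH; have [lt _ _] := stP j; exact: leq_ltn_trans IH lt.
have st_agree j m i : (i < (st j).1)%N -> (st (j + m)%N).2 i = (st j).2 i.
  move=> ij; elim: m => [|m IH]; first by rewrite addn0.
  rewrite addnS -IH; have [_ h _] := stP (j + m)%N; apply: h => /=.
  elim: m {IH} => [|m IH]; first by rewrite addn0.
  by rewrite addnS; have [lt _ _] := stP (j + m)%N; exact: ltn_trans IH lt.
(* Diagonal word: by [st_ge], letter [i] is already frozen at stage i + 1. *)
pose b i := (st i.+1).2 i.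
have bst j i : (i < (st j).1)%N -> b i = (st j).2 i.
  move=> ij; rewrite /b -(st_agree j i.+1 i ij) addnC.
  by rewrite (st_agree i.+1 j i (st_ge i.+1)).
have FF : ProperFilter (sum b n @[n --> \oo]) by exact: fmap_proper_filter.
have [|z [_ cz]] := cK (sum b n @[n --> \oo]) _.
  by exists 0%N => // n _; exact: Ksum.
have zc j : d <= `|z - c_ j|.
  have [_ _ [f cf fP]] := stP j.
  apply: le_trans (cf.2 _); apply: le_trans (ler_norm _).
  apply/ler_addgt0Pr => r r0.
  have [n Nn zn] := weak_cluster_eval (st j.+1).1 cz cf r0.
  have := fP b (bst j.+1) n Nn; move: zn; rewrite /= !(linear_formB _ _ cf.1).
  by rewrite ltr_norml; lra.
(* [z] is at distance at least [d] from the rational combinations, hence d / 2 from their real span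
   [Y], yet it is a weak cluster point of elements of [Y]. *)
pose Y := [set c : X | exists n (a : nat -> R), c = \sum_(i < n) a i *: y_ i].
have Ytrunc n (a : nat -> R) m : \sum_(i < n) a i *: y_ i =
    \sum_(i < n + m) (if (i < n)%N then a i else 0) *: y_ i.
  rewrite big_split_ord/= [X in _ = _ + X]big1 ?addr0.
    by apply: eq_bigr => i _; rewrite ltn_ord.
  by move=> i _; rewrite ltnNge leq_addr/= scale0r.
have d20 : 0 < d / 2 by rewrite divr_gt0.
have [||||f [cf fY fz]] := @subspace_separation Y z _ _ _ _ d20.
- by exists 0%N, (fun=> 0); rewrite big_ord0.
- move=> _ _ [n [a ->]] [m [a' ->]].
  exists (n + m)%N, (fun i => (if (i < n)%N then a i else 0) +
    (if (i < m)%N then a' i else 0)).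
  rewrite (Ytrunc n a m) (Ytrunc m a' n) [in X in _ + X]addnC -big_split/=.
  by apply: eq_bigr => i _; rewrite scalerDl.
- move=> r _ [n [a ->]]; exists n, (fun i => r * a i).
  by rewrite scaler_sumr; apply: eq_bigr => i _; rewrite scalerA.
- move=> _ [n [a ->]]; have [q qP] := rational_combination_dense y_ a n d20.
  have := zc (pickle q); rewrite /c_ pickleK/=; move: qP.
  set u := \sum_(i < n) _; set v := \sum_(i < size q) _ => uv zv.
  have : `|z - v| <= `|z - u| + `|u - v| by exact: ler_distD.
  lra.
have [n _] := weak_cluster_eval 0 cz cf d20.
rewrite (fY (sum b n)); last by exists n, (fun i => (b i)%:R).
by rewrite subr0 ltNge (le_trans fz)// ler_norm.
Qed.

End DistanceForm.

(** * Increasing sequences and the bidual *)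

Section Necessity.
Context (R : realType) (E : lcSolidRieszType R) (X : completeNormedModType R).

Definition range_hull (x_ : nat -> E) :=
  [set z : E | exists n, - x_ n <= z /\ z <= x_ n].

Lemma combination_in_hull (x_ : nat -> E) (c : nat -> R) n :
  (forall n, 0 <= x_ n) -> (forall n, x_ n <= x_ n.+1) ->
  (forall i, `|c i| <= 1) ->
  range_hull x_ (\sum_(i < n) c i *: (x_ i.+1 - x_ i)).
Proof.
move=> x0 x1 c1; exists n.
have le_sum (b : nat -> R) : (forall i, `|b i| <= 1) ->
    \sum_(i < n) b i *: (x_ i.+1 - x_ i) <= x_ n.
  move=> b1; apply: (@le_trans _ _ (x_ n - x_ 0)); last first.
    by rewrite rleBlDr -[leLHS]addr0 rleD.
  elim: n => [|n IH]; first by rewrite big_ord0 subrr.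
  rewrite big_ord_recr/= [leRHS](_ : _ = (x_ n - x_ 0) + (x_ n.+1 - x_ n)).
    apply: rleD => //; rewrite -rsub_ge0.
    rewrite -[X in X - _ *: _]scale1r -scalerBl.
    apply: riesz_scaler_ge0; rewrite ?rsub_ge0// subr_ge0.
    exact: le_trans (ler_norm _) (b1 n).
  by rewrite [RHS]addrC addrA subrK.
split; last exact: le_sum.
rewrite -rleN2 opprK -sumrN; under eq_bigr do rewrite -scaleNr.
by apply: (le_sum (fun i => - c i)) => i; rewrite normrN.
Qed.

(** Taking the signs of f(x_(i+1) - x_i) as coefficients gives a point of the hull at which f equals
    the whole variation. *)
Lemma hull_bounded_variation (x_ : nat -> E) (f : E -> R) (M : R) n : linear_form f ->
  (forall n, 0 <= x_ n) -> (forall n, x_ n <= x_ n.+1) ->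
  (forall z, range_hull x_ z -> `|f z| <= M) ->
  \sum_(i < n) `|f (x_ i.+1 - x_ i)| <= M.
Proof.
move=> lf x0 x1 fM; pose c i := Num.sg (f (x_ i.+1 - x_ i)).
have := fM _ (@combination_in_hull x_ c n x0 x1 _).
rewrite (linear_form_sum _ _ _ lf).
under eq_bigr do rewrite (linear_formZ _ _ lf) -normrEsg.
move=> h; apply: le_trans (ler_norm _) (h _) => i.
by rewrite /c normr_sg lern1 leq_b1.
Qed.

Lemma bounded_variation_cvg (a_ : nat -> R) (M : R) :
  (forall n, \sum_(i < n) `|a_ i.+1 - a_ i| <= M) -> cvg (a_ n @[n --> \oo]).
Proof.
move=> aM; apply/cauchy_cvgP/cauchy_exP => e e0.
have e20 : 0 < e / 2 by rewrite divr_gt0.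
have [N NP] := @real_series_tail R (fun i => a_ i.+1 - a_ i) M _ e20 aM.
exists (a_ N); exists N => // n Nn /=; rewrite -ball_normE/= distrC.
apply: (@le_lt_trans _ _ (e / 2)); last by rewrite ltr_pdivrMr// ltr_pMr// ltr1n.
apply: le_trans (NP n Nn); rewrite /= in Nn; rewrite -(subnKC Nn).
elim: (n - N)%N => [|m IH]; first by rewrite addn0 !subrr normr0.
rewrite addnS big_ord_recr/= addrAC; apply: le_trans (lerD IH (lexx _)).
by rewrite -[X in `|X - _|](subrK (a_ (N + m)%N)) -addrA addrC ler_normD.
Qed.

Lemma hull_form_bounded (x_ : nat -> E) (f : dual E) :
  topologically_bounded (range x_) ->
  exists M : R, forall z, range_hull x_ z -> `|f z| <= M.
Proof.
move=> /topologically_boundedP bx.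
have /lcsolid_base[V [V0 cV sV VU]] := dual_nbhs0 f; have [r r0 rV] := bx V V0 cV sV.
have ri : 0 <= r^-1 by rewrite invr_ge0 ltW.
exists r => z [n [xz zx]]; have Vx : V (r^-1 *: x_ n) by apply: rV; exists n.
have /VU/= : V (r^-1 *: z).
  apply: sV Vx _; apply: le_trans (rle_joinl _ _); apply: rjoin_le.
    exact: rleZ.
  by rewrite -scalerN; apply: rleZ; rewrite // -rleN2 opprK.
by rewrite linearZ/= normrM gtr0_norm ?invr_gt0// ler_pdivrMl// mulr1.
Qed.

(** [f] need not be positive, so f(x_n) converges by bounded variation rather than monotonicity. The
    limit is strongly continuous because the range of [x_] is a bounded set. *)
Lemma bidual_limit (x_ : nat -> E) :
  (forall n, 0 <= x_ n) -> (forall n, x_ n <= x_ n.+1) ->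
  topologically_bounded (range x_) ->
  exists L : dual (dual E), forall f : dual E, f (x_ n) @[n --> \oo] --> (L f : R).
Proof.
move=> x0 x1 bx; pose L (f : dual E) : R := lim (f (x_ n) @[n --> \oo]).
have fL (f : dual E) : f (x_ n) @[n --> \oo] --> L f.
  have [M fM] := hull_form_bounded f bx.
  have lf := dual_linear_form f.
  suff : cvg ((f (x_ n) : R) @[n --> \oo]) by [].
  apply: (@bounded_variation_cvg _ M) => n.
  under eq_bigr do rewrite -(linear_formB _ _ lf).
  exact: hull_bounded_variation.
have cL : L \in @continuous_linear R (dual E).
  apply/asboolP; split.
    move=> a f g; apply: (@cvg_lim R^o) => //.
    apply: (@cvgD _ R^o); last exact: fL.
    by apply: (@cvgZl_tmp _ R^o); exact: fL.
  move=> f; apply/(@cvgrPdist_le _ R^o _ _ (nbhs_filter (f : dual E))) => e e0.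
  have nf : nbhs (f : dual E)
      [set g : dual E | forall b, range x_ b -> `|f b - g b| <= e].
    have ent : entourage [set xy : R^o * R^o | `|xy.1 - xy.2| <= e].
      rewrite -entourage_from_ballE; exists e => // xy /=.
      by rewrite -ball_normE/=; exact: ltW.
    have := @fam_nbhs E R^o (@topologically_bounded R E) (range x_) _
      (dual_fun f) ent bx.
    exact: (@initial_continuous (dual E)
      {family @topologically_bounded R E, E -> R^o} (@dual_fun R E) f).
  apply: (@filterS _ _ (nbhs_filter (f : dual E)) _ _ _ nf) => g fg /=.
  apply/ler_addgt0Pr => r r0; have r20 : 0 < r / 2 by rewrite divr_gt0.
  near \oo => n; have fgn : `|f (x_ n) - g (x_ n)| <= e by apply: fg; exists n.
  have : `|L f - f (x_ n)| <= r / 2.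
    by near: n; exact: (@cvgr_dist_le _ R^o _ _ _ _ _ (fL f)).
  have : `|L g - g (x_ n)| <= r / 2.
    by near: n; exact: (@cvgr_dist_le _ R^o _ _ _ _ _ (fL g)).
  by move: fgn; rewrite !ler_norml; lra.
by exists (Dual cL).
Unshelve. all: by end_near. Qed.

Lemma hull_b_order_bounded (x_ : nat -> E) :
  (forall n, 0 <= x_ n) -> (forall n, x_ n <= x_ n.+1) ->
  topologically_bounded (range x_) ->
  topologically_b_order_bounded (range_hull x_).
Proof.
move=> x0 x1 bx; have [L fL] := bidual_limit x0 x1 bx.
have le_L (f : dual E) z n : positive_dual f -> z <= x_ n -> f z <= L f.
  move=> pf zx; have posf : positive_form f by split=> //; exact: dual_linear_form.
  apply/ler_addgt0Pr => r r0; near \oo => m.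
  have nm : (n <= m)%N by near: m; exists n.
  have := positive_form_le posf (le_trans zx (rincreasing x1 nm)).
  have : `|L f - f (x_ m)| <= r.
    by near: m; exact: (@cvgr_dist_le _ R^o _ _ _ _ _ (fL f)).
  by rewrite ler_norml; lra.
exists (- L), L => z [n [xz zx]]; split; apply/bidual_leP => f pf;
  last exact: le_L zx.
have lf := dual_linear_form f.
have := le_L f (- z) n pf; rewrite -[- z <= _]rleN2 opprK => /(_ xz).
rewrite (linear_formN _ lf); have -> : (- L) f = - L f by [].
have -> : bidual_embedding z f = f z by [].
lra.
Unshelve. all: by end_near. Qed.

Lemma gbwc_not_bounded_away (T : {linear E -> X}) (x_ : nat -> E) (e : R) :
  generalized_b_weakly_compact T ->
  (forall n, 0 <= x_ n) -> (forall n, x_ n <= x_ n.+1) ->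
  topologically_bounded (range x_) -> 0 < e ->
  ~ forall n, e < `|T (x_ n.+1) - T (x_ n)|.
Proof.
move=> gT x0 x1 bx e0; have cK := gT _ (hull_b_order_bounded x0 x1 bx).
pose K := closure (T @` range_hull x_ : set (weak_topology X)).
have TK z : range_hull x_ z -> K (T z) by move=> hz; apply: subset_closure; exists z.
apply: (@subseries_compact_not_bounded_away R X
  (fun i => T (x_ i.+1) - T (x_ i)) K e cK _ _ e0) => [b n|f cf].
  rewrite (_ : \sum_(i < n) _ = T (\sum_(i < n) (b i)%:R *: (x_ i.+1 - x_ i))).
    apply: TK; apply: (@combination_in_hull x_ (fun i => (b i)%:R)) => // i.
    by case: (b i); rewrite ?normr1 ?normr0.
  by rewrite [RHS]linear_sum; apply: eq_bigr => i _; rewrite [RHS]linearZ -linearB.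
(* Without continuity of [T], the bound for f o T on the hull comes from weak compactness of [K]. *)
have [M fM] : exists M : R, forall z, K z -> `|f z| <= M.
  have cfK : compact ((f : X -> R^o) @` K).
    apply: (@continuous_compact (weak_topology X) R^o) => //.
    apply: continuous_subspaceT.
    exact: (@weak_eval_continuous R X (contraction_dual cf)).
  have [M [_ Mb]] := compact_bounded cfK.
  exists (M + 1) => z Kz; apply: (Mb (M + 1)); first by rewrite ltrDl.
  by exists z.
exists M => n; under eq_bigr do rewrite -linearB.
apply: (@hull_bounded_variation x_ (f \o T)) => //.
  by move=> a u v; rewrite /= linearP cf.1.
by move=> z /TK; exact: fM.
Qed.

Lemma gbwc_monotone_convergence (T : {linear E -> X}) (x_ : nat -> E) :
  generalized_b_weakly_compact T ->
  (forall n, 0 <= x_ n) -> (forall m n, (m <= n)%N -> x_ m <= x_ n) ->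
  topologically_bounded (range x_) -> cvg (T (x_ n) @[n --> \oo]).
Proof.
move=> gT x0 xmono bx; apply/cauchy_cvgP/cauchy_exP => e e0.
apply: contrapT => nc; have e20 : 0 < e / 2 by rewrite divr_gt0.
have /choice[g gP] (N : nat) :
    exists n, (N <= n)%N /\ e / 2 < `|T (x_ n) - T (x_ N)|.
  apply: contrapT => /forallNP h; apply: nc; exists (T (x_ N)), N => // n Nn /=.
  rewrite -ball_normE/= distrC ltNge; apply/negP => en; apply: (h n); split=> //.
  apply: lt_le_trans en.
  by rewrite ltr_pdivrMr// ltr_pMr// ltr1n.
(* A subsequence whose increments all have images of norm above [e / 2]; it inherits the hypotheses
   on [x_]. *)
pose k_ n := iter n g 0.
apply: (@gbwc_not_bounded_away T (x_ \o k_) (e / 2) gT) => // [n /=|||n /=].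
- exact: x0.
- by move=> n /=; apply: xmono; case: (gP (k_ n)).
- by apply: topologically_bounded_sub bx => _ [n _ <-]; exists (k_ n).
- by case: (gP (k_ n)).
Qed.

End Necessity.

Theorem theorem3p4 (R : realType) (E : lcSolidRieszType R)
    (X : completeNormedModType R) (T : {linear E -> X}) :
  generalized_b_weakly_compact T <->
  forall x_ : nat -> E,
    (forall n, 0 <= x_ n) ->
    (forall m n, (m <= n)%N -> x_ m <= x_ n) ->
    topologically_bounded (range x_) ->
    cvg (T (x_ n) @[n --> \oo]).
Proof.
split=> [gT x_|]; first exact: gbwc_monotone_convergence.
exact: monotone_convergence_gbwc.
Qed.
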